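(* Let $F$ be a field of characteristic zero, let $X=\{x_1,\dots,x_M\}$ be a finite set, and let $f_1,f_2\in Br(X)$ be two non-zero elements of the free brace algebra over $F$ generated by $X$. Then the subalgebra $alg_{Br(X)}(f_1,f_2)$ of $Br(X)$ generated by $f_1,f_2$ is a free brace algebra.
   Context: A brace algebra over $F$ is an $F$-vector space $A$ with a family of multilinear operations $A^{\otimes n}\to A$, $a_n\otimes\dots\otimes a_1\mapsto\langle a_n,\dots,a_2;a_1\rangle$, for all $n\ge 2$ (with the convention $\langle a\rangle=a$), such that for all $a_1,\dots,a_m,b_1,\dots,b_n,c\in A$: $$\langle a_m,\dots,a_1;\langle b_n,\dots,b_1;c\rangle\rangle=\sum\langle V_{2n},\langle V_{2n-1};b_n\rangle,\dots,V_4,\langle V_3;b_2\rangle,V_2,\langle V_1;b_1\rangle,V_0;c\rangle,$$ the sum running over all partitions of the ordered set $\{a_m,\dots,a_1\}$ into (possibly empty) consecutive intervals $V_{2n}\sqcup\dots\sqcup V_0$ (in this order). $Br(X)$ denotes the free brace algebra over $F$ generated by $X$. Concretely, normal brace words on $X$ are defined recursively: each letter $x\in X$ is a normal brace word, and if $x\in X$ and $u_1,\dots,u_n$ ($n\ge1$) are normal brace words, then $\langle u_n,\dots,u_1;x\rangle$ is a normal brace word. The set of normal brace words is an $F$-basis of $Br(X)$, and the operations are the multilinear ones determined recursively by: $\langle v_m,\dots,v_1;x\rangle$ is the normal brace word itself for $x\in X$, and, for $w=\langle u_n,\dots,u_1;x\rangle$, $\langle v_m,\dots,v_1;w\rangle=\sum\langle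 V_{2n},\langle V_{2n-1};u_n\rangle,\dots,V_2,\langle V_1;u_1\rangle,V_0;x\rangle$, the sum over partitions of $\{v_m,\dots,v_1\}$ into possibly empty consecutive intervals $V_{2n}\sqcup\dots\sqcup V_0$. A brace algebra is free if it is isomorphic to $Br(Y)$ for some set $Y$. *)

(* Defs.v *)
From HB Require Import structures.
From mathcomp Require Import all_boot all_order all_algebra.
From mathcomp Require Import finmap.
From mathcomp.multinomials Require Import monalg.
From mathcomp Require Import boolp.

Set Implicit Arguments.
Unset Strict Implicit.
Unset Printing Implicit Defensive.

Import GRing.Theory.
Local Open Scope ring_scope.

(* Sequences are read from left to right exactly as in the bracket notation:  *)
(* [:: a_n; ...; a_2] stands for the arguments a_n, ..., a_2 of               *)
(* <a_n, ..., a_2; a_1>.                                                      *)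

Section Insertions.
Variable T : Type.

Definition splits (s : seq T) : seq (seq T * seq T) :=
  [seq (take i s, drop i s) | i <- iota 0 (size s).+1].

Variable op : seq T -> T -> seq T.

(* For us = [:: u_n; ...; u_1], the list (with multiplicities) of all         *)
(*   V_2n ++ w_n :: V_(2n-2) ++ ... ++ w_1 :: V_0                             *)
(* where vs = V_2n ++ V_(2n-1) ++ ... ++ V_0 ranges over the decompositions   *)
(* of vs into 2n+1 possibly empty consecutive intervals, and each w_i over    *)
(* the terms of op V_(2i-1) u_i.                                              *)
Fixpoint insertions (vs us : seq T) : seq (seq T) :=
  if us is u :: us' then
    flatten [seq
      flatten [seq
        [seq p.1 ++ w :: r | w <- op q.1 u, r <- insertions q.2 us']
      | q <- splits p.2]
    | p <- splits vs]
  else [:: vs].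

End Insertions.
Arguments insertions : simpl never.

(* brace s a is <s; a>; the operation of arity n is brace on sequences of     *)
(* size n.-1, and brace [::] a is the conventional <a> = a.                   *)
HB.mixin Record Lmodule_isBraceAlg (F : fieldType) A of GRing.Lmodule F A := {
  brace : seq A -> A -> A;
  brace_nil : forall a, brace [::] a = a;
  brace_linearl : forall (s t : seq A) (a : A) (k : F) (x y : A),
    brace (s ++ (k *: x + y) :: t) a =
    k *: brace (s ++ x :: t) a + brace (s ++ y :: t) a;
  brace_linearr : forall (s : seq A) (k : F) (x y : A),
    brace s (k *: x + y) = k *: brace s x + brace s y;
  brace_brace : forall (s t : seq A) (c : A),
    brace s (brace t c) =
    \sum_(l <- insertions (fun V b => [:: brace V b]) s t) brace l c
}.

#[short(type="braceAlgType")]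
HB.structure Definition BraceAlg (F : fieldType) :=
  { A of GRing.Lmodule F A & Lmodule_isBraceAlg F A }.

(* Normal brace words: BNode x [::] is the letter x, and BNode x us, for us   *)
(* nonempty, is <us; x>.                                                      *)
Inductive bword (X : Type) : Type := BNode of X & seq (bword X).

Section BwordInd.
Variables (X : Type) (P : bword X -> Prop).
Hypothesis PN : forall x us, foldr (fun u => and (P u)) True us -> P (BNode x us).

Fixpoint bword_nested_ind (w : bword X) : P w :=
  let: BNode x us := w in
  PN x ((fix loop (us : seq (bword X)) : foldr (fun u => and (P u)) True us :=
     if us is u :: us' then conj (bword_nested_ind u) (loop us') else I) us).
End BwordInd.

Fixpoint bword_code X (w : bword X) : GenTree.tree X :=
  let: BNode x us := w in
  GenTree.Node 0 (GenTree.Leaf x :: map (@bword_code X) us).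

Fixpoint bword_decode X (t : GenTree.tree X) : option (bword X) :=
  if t is GenTree.Node _ (GenTree.Leaf x :: ts) then
    Some (BNode x (pmap (@bword_decode X) ts))
  else None.

Lemma bword_codeK X : pcancel (@bword_code X) (@bword_decode X).
Proof.
elim/bword_nested_ind => x us /= IH; congr (Some (BNode _ _)).
by elim: us IH => //= u us IHus [-> /IHus ->].
Qed.

HB.instance Definition _ (X : choiceType) :=
  Choice.copy (bword X) (pcan_type (@bword_codeK X)).

(* The terms, with multiplicities, of the sum of words <vs; w>.               *)
Fixpoint wbrace X (vs : seq (bword X)) (w : bword X) {struct w} :
    seq (bword X) :=
  let: BNode x us := w in
  [seq BNode x l | l <- insertions (@wbrace X) vs us].

(* The free F-module on the normal brace words.                               *)
Definition Br (F : fieldType) (X : choiceType) : Type := {malg F[bword X]}.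
HB.instance Definition _ (F : fieldType) (X : choiceType) :=
  GRing.Lmodule.copy (Br F X) {malg F[bword X]}.

Section BraceOfWords.
Variables (F : fieldType) (X : choiceType).

Definition Br_word (w : bword X) : Br F X := << w >>.

Definition linext (V : lmodType F) (h : bword X -> V) (f : Br F X) : V :=
  \sum_(w <- msupp f) f@_w *: h w.

Fixpoint mlext (V : lmodType F) (h : seq (bword X) -> V) (fs : seq (Br F X)) :
    V :=
  if fs is f :: fs' then linext (fun w => mlext (fun vs => h (w :: vs)) fs') f
  else h [::].

Definition Br_brace (fs : seq (Br F X)) (g : Br F X) : Br F X :=
  mlext (fun vs =>
    linext (fun w => \sum_(t <- wbrace vs w) Br_word t) g) fs.

End BraceOfWords.

Lemma splits_nil (T : Type) : splits [::] = [:: ([::] : seq T, [::])].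
Proof. by []. Qed.

Lemma splits_cons (T : Type) (x : T) s :
  splits (x :: s) = ([::], x :: s) :: [seq (x :: p.1, p.2) | p <- splits s].
Proof. by rewrite /splits /= (iotaDl 1 1) -!map_comp. Qed.

Lemma splits_map (T U : Type) (f : T -> U) s :
  splits (map f s) = [seq (map f p.1, map f p.2) | p <- splits s].
Proof.
rewrite /splits size_map -map_comp; apply: eq_map => i /=.
by rewrite map_take map_drop.
Qed.

Local Opaque splits.

Section SplitSums.
Variables (T : Type) (V : nmodType).
Implicit Types (s t vs us : seq T).

Lemma big_splits_nil (G : seq T -> seq T -> V) :
  \sum_(p <- splits [::]) G p.1 p.2 = G [::] [::].
Proof. by rewrite splits_nil big_seq1. Qed.

Lemma big_splits_cons (G : seq T -> seq T -> V) x s :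
  \sum_(p <- splits (x :: s)) G p.1 p.2 =
  G [::] (x :: s) + \sum_(p <- splits s) G (x :: p.1) p.2.
Proof. by rewrite splits_cons big_cons big_map. Qed.

Lemma big_splits_cat (G : seq T -> seq T -> V) s x t :
  \sum_(p <- splits (s ++ x :: t)) G p.1 p.2 =
  \sum_(p <- splits s) G p.1 (p.2 ++ x :: t) +
  \sum_(p <- splits t) G (s ++ x :: p.1) p.2.
Proof.
elim: s G => [|y s IHs] G /=.
  by rewrite big_splits_cons splits_nil big_seq1.
rewrite [LHS]big_splits_cons.
rewrite (big_splits_cons (fun a b => G a (b ++ x :: t))) -!addrA.
by congr (_ + _); have /= -> := IHs (fun a b => G (y :: a) b).
Qed.

Lemma big_splitsA (G : seq T -> seq T -> seq T -> V) s :
  \sum_(p <- splits s) \sum_(q <- splits p.2) G p.1 q.1 q.2 =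
  \sum_(p <- splits s) \sum_(q <- splits p.1) G q.1 q.2 p.2.
Proof.
elim: s G => [|x s IHs] G; first by rewrite !splits_nil !big_seq1.
rewrite (big_splits_cons (fun a b => \sum_(q <- splits b) G a q.1 q.2)).
rewrite (big_splits_cons (fun a b => \sum_(q <- splits a) G q.1 q.2 b)).
rewrite [in LHS]big_splits_cons (IHs (fun a b c => G (x :: a) b c)).
rewrite (big_splits_nil (fun a b => G a b (x :: s))) -addrA; congr (_ + _).
rewrite -big_split /=; apply: eq_bigr => p _.
by rewrite (big_splits_cons (fun a b => G a b p.2)).
Qed.

Variable op : seq T -> T -> seq T.

Lemma big_insertions_cons (F : seq T -> V) vs u us :
  \sum_(l <- insertions op vs (u :: us)) F l =
  \sum_(p <- splits vs) \sum_(q <- splits p.2)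
    \sum_(w <- op q.1 u) \sum_(r <- insertions op q.2 us) F (p.1 ++ w :: r).
Proof.
rewrite /= big_flatten big_map; apply: eq_bigr => p _.
rewrite big_flatten big_map; apply: eq_bigr => q _.
by rewrite big_allpairs_dep.
Qed.

Lemma big_insertions_splits (G : seq T -> seq T -> V) vs us :
  \sum_(l <- insertions op vs us) \sum_(p <- splits l) G p.1 p.2 =
  \sum_(p <- splits vs) \sum_(q <- splits us)
    \sum_(l <- insertions op p.1 q.1) \sum_(r <- insertions op p.2 q.2) G l r.
Proof.
elim: us vs G => [|u us IHus] vs G.
  rewrite big_seq1; apply: eq_bigr => p _.
  by rewrite !splits_nil !big_seq1.
rewrite big_insertions_cons.
transitivity (
  \sum_(p <- splits vs) \sum_(q <- splits p.2) \sum_(w <- op q.1 u)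
    \sum_(r <- insertions op q.2 us)
      \sum_(x <- splits p.1) G x.1 (x.2 ++ w :: r) +
  \sum_(p <- splits vs) \sum_(q <- splits p.2) \sum_(w <- op q.1 u)
    \sum_(r <- insertions op q.2 us)
      \sum_(x <- splits r) G (p.1 ++ w :: x.1) x.2).
  rewrite -big_split; apply: eq_bigr => p _.
  rewrite -big_split; apply: eq_bigr => q _.
  rewrite -big_split; apply: eq_bigr => w _.
  rewrite -big_split; apply: eq_bigr => r _.
  exact: big_splits_cat.
under [RHS]eq_bigr => p _ do rewrite splits_cons big_cons big_map /= big_seq1.
rewrite [RHS]big_split; congr (_ + _).
  under [RHS]eq_bigr => p _ do rewrite big_insertions_cons.
  rewrite (big_splitsA (fun a b c => \sum_(q <- splits c) \sum_(w <- op q.1 u)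
    \sum_(r <- insertions op q.2 us) G a (b ++ w :: r))).
  apply: eq_bigr => p _; rewrite [RHS]exchange_big; apply: eq_bigr => q _.
  rewrite [RHS]exchange_big; apply: eq_bigr => w _.
  by rewrite [RHS]exchange_big.
pose K x c z w :=
  \sum_(q <- splits us) \sum_(l <- insertions op c q.1)
    \sum_(r <- insertions op z q.2) G (x ++ w :: l) r.
transitivity (\sum_(p <- splits vs) \sum_(a <- splits p.1)
   \sum_(b <- splits a.2) \sum_(w <- op b.1 u) K a.1 b.2 p.2 w).
  rewrite -(big_splitsA (fun x y z =>
    \sum_(b <- splits y) \sum_(w <- op b.1 u) K x b.2 z w)).
  apply: eq_bigr => p _.
  rewrite -(big_splitsA (fun x y z => \sum_(w <- op x u) K p.1 y z w)).
  apply: eq_bigr => q _; rewrite [RHS]exchange_big; apply: eq_bigr => w _.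
  by rewrite (IHus _ (fun a b => G (p.1 ++ w :: a) b)).
apply: eq_bigr => p _.
under [RHS]eq_bigr => q _ do rewrite big_insertions_cons.
rewrite [RHS]exchange_big; apply: eq_bigr => a _.
rewrite [RHS]exchange_big; apply: eq_bigr => b _.
by rewrite [RHS]exchange_big.
Qed.

Lemma big_insertions_cat (F : seq T -> V) vs us1 u us2 :
  \sum_(l <- insertions op vs (us1 ++ u :: us2)) F l =
  \sum_(p <- splits vs) \sum_(q <- splits p.2)
    \sum_(l <- insertions op p.1 us1) \sum_(w <- op q.1 u)
      \sum_(r <- insertions op q.2 us2) F (l ++ w :: r).
Proof.
elim: us1 vs F => [|a us1 IH] vs F.
  rewrite big_insertions_cons; apply: eq_bigr => p _; apply: eq_bigr => q _.
  by rewrite big_seq1.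
rewrite big_insertions_cons.
pose H l c := \sum_(q <- splits c) \sum_(w <- op q.1 u)
      \sum_(r <- insertions op q.2 us2) F (l ++ w :: r).
transitivity (\sum_(p <- splits vs) \sum_(p1 <- splits p.1)
   \sum_(q <- splits p1.2) \sum_(w <- op q.1 a)
     \sum_(l <- insertions op q.2 us1) H (p1.1 ++ w :: l) p.2).
  rewrite -(big_splitsA (fun x y z => \sum_(q <- splits y) \sum_(w <- op q.1 a)
     \sum_(l <- insertions op q.2 us1) H (x ++ w :: l) z)).
  apply: eq_bigr => p _.
  rewrite -(big_splitsA (fun x y z => \sum_(w <- op x a)
    \sum_(l <- insertions op y us1) H (p.1 ++ w :: l) z)).
  apply: eq_bigr => q _; rewrite [RHS]exchange_big; apply: eq_bigr => w _ /=.
  rewrite (IH _ (fun r => F (p.1 ++ w :: r))); apply: eq_bigr => b _.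
  rewrite exchange_big; apply: eq_bigr => l _; apply: eq_bigr => c _.
  by apply: eq_bigr => w' _; apply: eq_bigr => r _; rewrite -catA.
apply: eq_bigr => p _.
under [RHS]eq_bigr => q _ do rewrite big_insertions_cons.
rewrite [RHS]exchange_big; apply: eq_bigr => x _.
rewrite [RHS]exchange_big; apply: eq_bigr => q _.
rewrite [RHS]exchange_big; apply: eq_bigr => w _.
by rewrite [RHS]exchange_big.
Qed.

(* Composition of insertions, given the corresponding property of op on the   *)
(* elements receiving the insertions.                                         *)
Lemma big_insertionsA (F : seq T -> V) vs us ts :
  foldr (fun c => and (forall (G : T -> V) s t,
    \sum_(w <- op t c) \sum_(x <- op s w) G x =
    \sum_(l <- insertions op s t) \sum_(x <- op l c) G x)) True ts ->
  \sum_(l <- insertions op us ts) \sum_(r <- insertions op vs l) F r =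
  \sum_(l <- insertions op vs us) \sum_(r <- insertions op l ts) F r.
Proof.
elim: ts us vs F => [|c ts IH] us vs F /=.
  by move=> _; rewrite big_seq1; apply: eq_bigr => l _; rewrite big_seq1.
case=> Hc /IH{}IH.
pose K x y z := \sum_(w <- op y c) \sum_(r <- insertions op z ts) F (x ++ w :: r).
transitivity (\sum_(p <- splits us) \sum_(q <- splits p.2)
   \sum_(a <- splits vs) \sum_(b <- splits a.2)
   \sum_(x <- insertions op a.1 p.1)
   \sum_(y <- insertions op b.1 q.1)
   \sum_(z <- insertions op b.2 q.2) K x y z).
  rewrite (big_insertions_cons (fun l => \sum_(r <- insertions op vs l) F r)).
  apply: eq_bigr => p _; apply: eq_bigr => q _.
  under eq_bigr => w _ do under eq_bigr => r _ do rewrite big_insertions_cat.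
  under eq_bigr => w _ do rewrite exchange_big.
  rewrite exchange_big; apply: eq_bigr => a _ /=.
  under eq_bigr => w _ do rewrite exchange_big.
  rewrite exchange_big; apply: eq_bigr => b _ /=.
  under eq_bigr => w _ do rewrite exchange_big.
  rewrite exchange_big; apply: eq_bigr => x _ /=.
  under eq_bigr => w _ do rewrite exchange_big /=.
  under eq_bigr => w _ do under eq_bigr => w' _ do
    rewrite (IH _ _ (fun r => F (x ++ w' :: r))).
  rewrite (Hc (fun w' => \sum_(l <- insertions op b.2 q.2)
    \sum_(r <- insertions op l ts) F (x ++ w' :: r))).
  by apply: eq_bigr => y _; rewrite exchange_big.
under [RHS]eq_bigr => l _ do rewrite big_insertions_cons.
rewrite (big_insertions_splits (fun x s => \sum_(q <- splits s) K x q.1 q.2)).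
rewrite [RHS]exchange_big; apply: eq_bigr => p _.
under [RHS]eq_bigr => a _ do under eq_bigr => l _ do
  rewrite (big_insertions_splits (fun y z => K l y z)).
rewrite [LHS]exchange_big; apply: eq_bigr => a _.
rewrite [LHS]exchange_big; rewrite [RHS]exchange_big; apply: eq_bigr => b _ /=.
by rewrite [RHS]exchange_big.
Qed.

End SplitSums.

Lemma big_wbraceA (X : Type) (V : nmodType) (G : bword X -> V) s t w :
  \sum_(x <- wbrace t w) \sum_(y <- wbrace s x) G y =
  \sum_(l <- insertions (@wbrace X) s t) \sum_(y <- wbrace l w) G y.
Proof.
elim/bword_nested_ind: w s t G => x us IH s t G.
rewrite big_map; under eq_bigr => l _ do rewrite big_map.
under [RHS]eq_bigr => l _ do rewrite big_map.
apply: (big_insertionsA (fun l => G (BNode x l))).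
elim: us IH => //= u us IHus [Hu /IHus Hus]; split => // *; exact: Hu.
Qed.

Lemma insertions_cons (T : Type) (op : seq T -> T -> seq T) vs u us :
  insertions op vs (u :: us) =
  flatten [seq
    flatten [seq
      [seq p.1 ++ w :: r | w <- op q.1 u, r <- insertions op q.2 us]
    | q <- splits p.2]
  | p <- splits vs].
Proof. by []. Qed.

Lemma insertions_map (T U : Type) (f : T -> U) (op : seq T -> T -> seq T)
    (op' : seq U -> U -> seq U) vs us :
  (forall s b, op' (map f s) (f b) = map f (op s b)) ->
  insertions op' (map f vs) (map f us) = map (map f) (insertions op vs us).
Proof.
move=> opE; elim: us vs => [|u us IHus] vs //.
rewrite map_cons !insertions_cons splits_map map_flatten -!map_comp.
congr flatten; apply: eq_map => p /=; rewrite splits_map map_flatten -!map_comp.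
congr flatten; apply: eq_map => q /=; rewrite opE IHus.
rewrite map_allpairs allpairs_mapl allpairs_mapr.
by apply: eq_allpairs => // w r; rewrite map_cat.
Qed.

Lemma wbrace_nil (X : Type) (w : bword X) : wbrace [::] w = [:: w].
Proof.
elim/bword_nested_ind: w => x us IH.
suff /= -> : insertions (@wbrace X) [::] us = [:: us] by [].
elim: us IH => //= u us IHus [Hu /IHus Hus].
by rewrite insertions_cons splits_nil /= splits_nil /= Hu Hus.
Qed.

Section Multilinear.
Variables (F : fieldType) (A V : lmodType F).

Definition multilinear (h : seq A -> V) :=
  forall s t k x y,
    h (s ++ (k *: x + y) :: t) = k *: h (s ++ x :: t) + h (s ++ y :: t).

Lemma multilinear_ctx h u b :
  multilinear h -> multilinear (fun r => h (u ++ b :: r)).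
Proof. by move=> hP s t k x y; rewrite -!cat_cons !catA hP. Qed.

Lemma linear_sum_scale (h : A -> V) (I : Type) (r : seq I) (c : I -> F) E :
  (forall k x y, h (k *: x + y) = k *: h x + h y) ->
  h (\sum_(i <- r) c i *: E i) = \sum_(i <- r) c i *: h (E i).
Proof.
move=> hP.
have h0 : h 0 = 0.
  by have := hP (-1) 0 0; rewrite scaler0 addr0 scaleN1r addNr.
by elim: r => [|i r IHr]; rewrite ?big_nil // !big_cons hP IHr.
Qed.

Lemma linear_sum (h : A -> V) (I : Type) (r : seq I) E :
  (forall k x y, h (k *: x + y) = k *: h x + h y) ->
  h (\sum_(i <- r) E i) = \sum_(i <- r) h (E i).
Proof.
move=> hP; have := linear_sum_scale r (fun=> 1) E hP.
by under eq_bigr do rewrite scale1r; under [RHS]eq_bigr do rewrite scale1r.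
Qed.

Variable br : seq A -> A -> A.
Hypothesis brl : forall a, forall s t k x y,
    br (s ++ (k *: x + y) :: t) a = k *: br (s ++ x :: t) a + br (s ++ y :: t) a.
Hypothesis brr : forall s k x y, br s (k *: x + y) = k *: br s x + br s y.

Let ins := insertions (fun V b => [:: br V b]).

Lemma big_ins_cons h vs u us :
  \sum_(l <- ins vs (u :: us)) h l =
  \sum_(p <- splits vs) \sum_(q <- splits p.2)
    \sum_(r <- ins q.2 us) h (p.1 ++ br q.1 u :: r) :> V.
Proof.
rewrite big_insertions_cons; apply: eq_bigr => p _; apply: eq_bigr => q _.
by rewrite big_seq1.
Qed.

Lemma multilinear_insr h vs : multilinear h ->
  multilinear (fun us => \sum_(l <- ins vs us) h l).
Proof.
move=> hP s t k x y; elim: s h vs hP => [|u s IHs] h vs hP.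
  rewrite !cat0s !big_ins_cons scaler_sumr -big_split; apply: eq_bigr => p _.
  rewrite scaler_sumr -big_split; apply: eq_bigr => q _.
  rewrite scaler_sumr -big_split; apply: eq_bigr => r _ /=.
  by rewrite brr hP.
rewrite !cat_cons !big_ins_cons scaler_sumr -big_split; apply: eq_bigr => p _.
rewrite scaler_sumr -big_split; apply: eq_bigr => q _ /=.
by apply: (IHs (fun r => h (p.1 ++ br q.1 u :: r))); apply: multilinear_ctx.
Qed.

Lemma multilinear_insl h us : multilinear h ->
  multilinear (fun vs => \sum_(l <- ins vs us) h l).
Proof.
move=> hP s t k x y; elim: us h s t hP => [|u us IHus] h s t hP.
  by rewrite !big_seq1.
rewrite !big_ins_cons.
pose G a b := \sum_(q <- splits b) \sum_(r <- ins q.2 us) h (a ++ br q.1 u :: r).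
have EG := big_splits_cat G; rewrite /G /= in EG; rewrite !EG {EG} scalerDr [RHS]addrACA; congr (_ + _); last first.
  rewrite scaler_sumr -big_split; apply: eq_bigr => p _.
  rewrite scaler_sumr -big_split; apply: eq_bigr => q _.
  rewrite scaler_sumr -big_split; apply: eq_bigr => r _ /=.
  by rewrite -!catA !cat_cons hP.
rewrite scaler_sumr -big_split; apply: eq_bigr => p _.
pose H a b := \sum_(r <- ins b us) h (p.1 ++ br a u :: r).
have EH := big_splits_cat H; rewrite /H /= in EH; rewrite !EH {EH} scalerDr [RHS]addrACA; congr (_ + _).
  rewrite scaler_sumr -big_split; apply: eq_bigr => q _ /=.
  by apply: (IHus (fun r => h (p.1 ++ br q.1 u :: r))); apply: multilinear_ctx.
rewrite scaler_sumr -big_split; apply: eq_bigr => q _.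
rewrite scaler_sumr -big_split; apply: eq_bigr => r _ /=.
by rewrite brl hP.
Qed.

End Multilinear.

Section BrTheory.
Variables (F : fieldType) (X : choiceType).
Local Notation A := (Br F X).

Lemma linextE (V : lmodType F) (h : bword X -> V) (f : A) (D : {fset bword X}) :
  (msupp f `<=` D)%fset -> linext h f = \sum_(w <- D) f@_w *: h w.
Proof.
move=> sfD; rewrite /linext (big_fset_incl _ sfD) // => w _ nfw.
by rewrite mcoeff_outdom ?scale0r.
Qed.

Lemma linext_linear (V : lmodType F) (h : bword X -> V) k (x y : A) :
  linext h (k *: x + y) = k *: linext h x + linext h y.
Proof.
pose D := (msupp x `|` msupp y)%fset.
have xD : (msupp x `<=` D)%fset by exact: fsubsetUl.
have yD : (msupp y `<=` D)%fset by exact: fsubsetUr.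
have xyD : (msupp (k *: x + y) `<=` D)%fset.
  apply: fsubset_trans (msuppD_le _ _) _; apply: fsetSU; exact: msuppZ_le.
rewrite (linextE _ xD) (linextE _ yD) (linextE _ xyD) scaler_sumr -big_split.
apply: eq_bigr => w _ /=.
by rewrite mcoeffD mcoeffZ scalerDl scalerA.
Qed.

Lemma linext_word (V : lmodType F) (h : bword X -> V) w :
  linext h (Br_word F w) = h w.
Proof.
rewrite (linextE _ (msuppU_le : (_ `<=` [fset w])%fset)) big_seq_fset1.
by rewrite mcoeffUU scale1r.
Qed.

Lemma Br_wordE (f : A) : f = \sum_(w <- msupp f) f@_w *: Br_word F w.
Proof.
rewrite {1}[f]monalgE; apply: eq_bigr => w _; apply/malgP => v.
by rewrite mcoeffZ !mcoeffU mulr_natr.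
Qed.

Lemma linext_eq (V : lmodType F) (h1 h2 : bword X -> V) (f : A) :
  h1 =1 h2 -> linext h1 f = linext h2 f.
Proof. by move=> eqh; apply: eq_bigr => w _; rewrite eqh. Qed.

Lemma linext_lin (V : lmodType F) (h1 h2 : bword X -> V) (f : A) k :
  linext (fun w => k *: h1 w + h2 w) f = k *: linext h1 f + linext h2 f.
Proof.
rewrite /linext scaler_sumr -big_split; apply: eq_bigr => w _ /=.
by rewrite scalerDr !scalerA mulrC.
Qed.

Lemma mlext_eq (V : lmodType F) (h1 h2 : seq (bword X) -> V) (fs : seq A) :
  h1 =1 h2 -> mlext h1 fs = mlext h2 fs.
Proof.
elim: fs h1 h2 => [|f fs IHfs] h1 h2 eqh //=; apply: linext_eq => w.
by apply: IHfs => vs; apply: eqh.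
Qed.

Lemma mlext_lin (V : lmodType F) (h1 h2 : seq (bword X) -> V) (fs : seq A) k :
  mlext (fun vs => k *: h1 vs + h2 vs) fs = k *: mlext h1 fs + mlext h2 fs.
Proof.
elim: fs h1 h2 => [|f fs IHfs] h1 h2 //=.
by rewrite -linext_lin; apply: linext_eq => w; apply: IHfs.
Qed.

Lemma mlext_multilinear (V : lmodType F) (h : seq (bword X) -> V) :
  multilinear (mlext h : seq A -> V).
Proof.
move=> s t k x y; elim: s h => [|f s IHs] h /=; first exact: linext_linear.
by rewrite -linext_lin; apply: linext_eq => w; apply: IHs.
Qed.

Lemma mlext_word (V : lmodType F) (h : seq (bword X) -> V) vs :
  mlext h (map (@Br_word F X) vs) = h vs.
Proof. by elim: vs h => [|v vs IHvs] h //=; rewrite linext_word IHvs. Qed.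

Lemma multilinear_eq (V : lmodType F) (h1 h2 : seq A -> V) :
  multilinear h1 -> multilinear h2 ->
  (forall vs, h1 (map (@Br_word F X) vs) = h2 (map (@Br_word F X) vs)) ->
  h1 =1 h2.
Proof.
move=> h1P h2P eqh fs; rewrite -[fs]cat0s -[[::]]/(map (@Br_word F X) [::]).
elim: fs [::] => [|f fs IHfs] vs; first by rewrite cats0 eqh.
rewrite [f]Br_wordE.
rewrite (linear_sum_scale (h := fun g => h1 (_ ++ g :: _))); last exact: h1P.
rewrite (linear_sum_scale (h := fun g => h2 (_ ++ g :: _))); last exact: h2P.
apply: eq_bigr => w _; congr (_ *: _).
by rewrite -!cat_rcons -map_rcons IHfs.
Qed.

Lemma linear_eq (V : lmodType F) (h1 h2 : A -> V) :
  (forall k x y, h1 (k *: x + y) = k *: h1 x + h1 y) ->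
  (forall k x y, h2 (k *: x + y) = k *: h2 x + h2 y) ->
  (forall w, h1 (Br_word F w) = h2 (Br_word F w)) -> h1 =1 h2.
Proof.
move=> h1P h2P eqh f; rewrite [f]Br_wordE.
by rewrite !linear_sum_scale //; apply: eq_bigr => w _; rewrite eqh.
Qed.

Lemma Br_brace_linearl (s t : seq A) (a : A) (k : F) (x y : A) :
  Br_brace (s ++ (k *: x + y) :: t) a =
  k *: Br_brace (s ++ x :: t) a + Br_brace (s ++ y :: t) a.
Proof. exact: mlext_multilinear. Qed.

Lemma Br_brace_linearr (s : seq A) (k : F) (x y : A) :
  Br_brace s (k *: x + y) = k *: Br_brace s x + Br_brace s y.
Proof. by rewrite -mlext_lin; apply: mlext_eq => vs; apply: linext_linear. Qed.

Lemma Br_brace_word vs w :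
  Br_brace (map (@Br_word F X) vs) (Br_word F w) =
  \sum_(t <- wbrace vs w) Br_word F t.
Proof. by rewrite /Br_brace mlext_word linext_word. Qed.

Lemma Br_brace_letter vs x :
  Br_brace (map (@Br_word F X) vs) (Br_word F (BNode x [::])) =
  Br_word F (BNode x vs).
Proof. by rewrite Br_brace_word big_seq1. Qed.

Lemma Br_brace_nil (a : A) : Br_brace [::] a = a.
Proof.
rewrite /Br_brace /= [RHS]Br_wordE; apply: eq_bigr => w _.
by rewrite wbrace_nil big_seq1.
Qed.

Lemma big_insertions_word (V : lmodType F) (h : seq A -> V) vs us :
  multilinear h ->
  \sum_(l <- insertions (fun V b => [:: Br_brace V b])
     (map (@Br_word F X) vs) (map (@Br_word F X) us)) h l =
  \sum_(l <- insertions (@wbrace X) vs us) h (map (@Br_word F X) l).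
Proof.
elim: us vs h => [|u us IHus] vs h hP; first by rewrite !big_seq1.
rewrite big_ins_cons big_insertions_cons splits_map big_map.
apply: eq_bigr => p _ /=; rewrite splits_map big_map.
apply: eq_bigr => q _ /=.
rewrite (IHus _ (fun r => h (_ ++ _ :: r))); last exact: multilinear_ctx.
rewrite exchange_big; apply: eq_bigr => r _; rewrite Br_brace_word.
rewrite (linear_sum (h := fun g => h (_ ++ g :: _))); last exact: hP.
by apply: eq_bigr => w _; rewrite map_cat.
Qed.

Lemma Br_brace_brace (s t : seq A) (c : A) :
  Br_brace s (Br_brace t c) =
  \sum_(l <- insertions (fun V b => [:: Br_brace V b]) s t) Br_brace l c.
Proof.
have brl (a : A) s1 s2 k x y := Br_brace_linearl s1 s2 a k x y.
have brP (a : A) : multilinear (fun s : seq A => Br_brace s a) by exact: brl.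
have brr := Br_brace_linearr.
move: s; apply: multilinear_eq => [|| us]; first exact: brP.
  exact: (multilinear_insl brl t (brP c)).
move: t; apply: multilinear_eq => [s t k x y||ts].
- by rewrite brl brr.
- exact: (multilinear_insr brr _ (brP c)).
move: c; apply: linear_eq => [k x y|k x y|w].
- by rewrite !Br_brace_linearr.
- rewrite scaler_sumr -big_split; apply: eq_bigr => l _.
  exact: Br_brace_linearr.
rewrite Br_brace_word (linear_sum _ _ (h := Br_brace _)); last first.
  exact: Br_brace_linearr.
under eq_bigr => v _ do rewrite Br_brace_word.
rewrite big_wbraceA big_insertions_word //.
by apply: eq_bigr => l _; rewrite Br_brace_word.
Qed.

HB.instance Definition _ := Lmodule_isBraceAlg.Build F (Br F X)
  Br_brace_nil Br_brace_linearl Br_brace_linearr Br_brace_brace.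

End BrTheory.

Section Subalgebra.
Variables (F : fieldType) (A : braceAlgType F).

Definition is_subalg (B : A -> Prop) : Prop :=
  [/\ B 0, (forall (k : F) x y, B x -> B y -> B (k *: x + y)) &
      forall s a, (forall x, x \in s -> B x) -> B a -> B (brace s a)].

(* The smallest subalgebra containing S.                                      *)
Definition subalg_gen (S : A -> Prop) : {pred A} :=
  [pred x | `[< forall B, is_subalg B -> (forall a, S a -> B a) -> B x >]].

Variable S : A -> Prop.

Lemma subalg_gen_submod_closed : submod_closed (subalg_gen S).
Proof.
split=> [|k x y /asboolP xS /asboolP yS]; apply/asboolP => B BA SB.
  by case: BA.
by case: (BA) => _ + _; apply; [apply: xS | apply: yS].
Qed.

Lemma subalg_brace_closed (s : seq A) (a : A) :
  {subset s <= subalg_gen S} -> a \in subalg_gen S -> brace s a \in subalg_gen S.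
Proof.
move=> sS /asboolP aS; apply/asboolP => B BA SB.
case: (BA) => _ _; apply; last exact: aS.
by move=> x /sS/asboolP; apply.
Qed.

HB.instance Definition _ :=
  GRing.isSubmodClosed.Build F A (subalg_gen S) subalg_gen_submod_closed.

(* The subalgebra generated by S, as a brace algebra with the operations      *)
(* induced by those of A.                                                     *)
Record subalg_gen_of : predArgType := SubalgGenOf {
  subalg_gen_val : A;
  _ : subalg_gen_val \in subalg_gen S
}.

HB.instance Definition _ := [isSub for subalg_gen_val].
HB.instance Definition _ := [Choice of subalg_gen_of by <:].
HB.instance Definition _ := [SubChoice_isSubLmodule of subalg_gen_of by <:].

Lemma subalg_brace_subproof (s : seq subalg_gen_of) (a : subalg_gen_of) :
  brace (map val s) (val a) \in subalg_gen S.
Proof.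
by apply: subalg_brace_closed (valP a) => _ /mapP[x _ ->]; apply: valP.
Qed.

Definition subalg_brace s a : subalg_gen_of :=
  SubalgGenOf (subalg_brace_subproof s a).

Lemma subalg_brace_nil a : subalg_brace [::] a = a.
Proof. by apply: val_inj; rewrite /= brace_nil. Qed.

Let subalg_gen_val_lin (k : F) (x y : subalg_gen_of) :
  subalg_gen_val (k *: x + y) = k *: subalg_gen_val x + subalg_gen_val y.
Proof. by []. Qed.

Lemma subalg_brace_linearl (s t : seq subalg_gen_of) (a : subalg_gen_of) (k : F) x y :
  subalg_brace (s ++ (k *: x + y) :: t) a =
  k *: subalg_brace (s ++ x :: t) a + subalg_brace (s ++ y :: t) a.
Proof.
apply: val_inj; rewrite [RHS]subalg_gen_val_lin /= !map_cat.
exact: brace_linearl.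
Qed.

Lemma subalg_brace_linearr (s : seq subalg_gen_of) (k : F) x y :
  subalg_brace s (k *: x + y) = k *: subalg_brace s x + subalg_brace s y.
Proof. by apply: val_inj; rewrite [RHS]subalg_gen_val_lin; apply: brace_linearr. Qed.

Lemma subalg_brace_brace (s t : seq subalg_gen_of) (c : subalg_gen_of) :
  subalg_brace s (subalg_brace t c) =
  \sum_(l <- insertions (fun V b => [:: subalg_brace V b]) s t) subalg_brace l c.
Proof.
apply: val_inj; rewrite raddf_sum /= brace_brace.
by rewrite (insertions_map (op := fun V b => [:: subalg_brace V b])) ?big_map.
Qed.

HB.instance Definition _ := Lmodule_isBraceAlg.Build F subalg_gen_of
  subalg_brace_nil subalg_brace_linearl subalg_brace_linearr subalg_brace_brace.

End Subalgebra.

Definition is_brace_iso (F : fieldType) (A B : braceAlgType F) (f : A -> B) :=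
  [/\ forall (k : F) x y, f (k *: x + y) = k *: f x + f y,
      forall s a, f (brace s a) = brace (map f s) (f a) &
      bijective f].

(* Y ranges over all sets: classically every type is a choiceType.            *)
Definition is_free_brace_alg (F : fieldType) (A : braceAlgType F) : Prop :=
  exists (Y : choiceType) (f : Br F Y -> A), is_brace_iso f.

(* Main.v *)
Require Import Defs.
From HB Require Import structures.
From mathcomp Require Import all_boot all_order all_algebra.
From mathcomp Require Import finmap.
From mathcomp.multinomials Require Import monalg.
From mathcomp Require Import boolp zify.

Set Implicit Arguments.
Unset Strict Implicit.
Unset Printing Implicit Defensive.

Import GRing.Theory.
Local Open Scope ring_scope.

(** Write A for the free brace algebra on X, H for its tensor space, with basis
the forests (sequences of words), and x*y for the product of H whose terms are
the insertions of the forest x into the forest y. The identity big_wbraceA says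
that A is a module over the associative algebra H, and a normal word
<u_n, ..., u_1; x> is the action of the forest u_n ... u_1 on the letter x: A is
free over H, with basis X. Two properties of H carry the theorem.

H is a free associative algebra, graded by the number of letters. Say that a
forest z is leaf-first when its first tree is a single letter. Among the terms
of the action of z on a word, a unique one has its leftmost leaf as deep as
possible with as many siblings as possible: all of z is grafted on the leftmost
leaf of that word (wbrace_attach). This leading term determines z and the word,
and every word other than a letter occurs as one, so the augmentation ideal of H
is freely generated, as a right ideal, by the leaf-first forests. Comparing
coefficients of these generators shortens any homogeneous relation sum a_i f_i =
0 with a_i in H and f_i in A until some coefficient is a nonzero scalar
(weak_algorithm). Hence a nontrivial homogeneous relation a_1 f_1 + a_2 f_2 = 0,
with f_1 and f_2 nonzero, makes the one of larger degree a left H-multiple of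
the other.

The part of maximal length of x*y is the shuffle of x and y. In characteristic
zero the shuffle algebra is a domain, because the largest word of a shuffle is
strictly monotone in both arguments and its multiplicity is a positive integer.
Let B be the image of an evaluation morphism, choose a linear projection of A
onto B, and extend it to tensors: it respects shuffles, so that if b and b*c are
tensors over B and b is not zero, then the part of c killed by the projection is
zero, since its top component has zero shuffle with the top component of b.
Thus c is a tensor over B (ev_forest_cancel).

Now let f_1 and f_2 be homogeneous, of degrees d_1 <= d_2, and suppose that the
evaluation morphism y_i |-> f_i has a kernel. An element P of minimal weight in
the kernel reads U_1 y_1 + U_2 y_2, and evaluation is injective on the U_i. The
first property gives f_2 = c f_1, whence (image of U_2)*c = -(image of U_1), and
by the second property c is a tensor over the subalgebra; as its degree
d_2 - d_1 is smaller than d_2, it involves f_1 only. So f_2 belongs to the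
subalgebra generated by f_1.

For arbitrary f_1 and f_2, consider the components of top degree. If they are
free generators, so are f_1 and f_2. Otherwise some h in the subalgebra generated
by f_1 has the same top component as f_2, and f_2 can be replaced by f_2 - h, of
smaller degree, without changing the subalgebra generated. This ends either with
two free generators or with f_2 = h, and a nonzero element alone always generates
freely. *)

(** * Linear extension *)

Section LinearExtension.
Variables (F : fieldType) (K : choiceType) (V : lmodType F).
Implicit Types (h : K -> V) (f : {malg F[K]}).

Definition lext h f : V := \sum_(k <- msupp f) f@_k *: h k.

Lemma lextEw h f (D : {fset K}) :
  (msupp f `<=` D)%fset -> lext h f = \sum_(k <- D) f@_k *: h k.
Proof.
move=> sfD; rewrite /lext (big_fset_incl _ sfD) // => w _ nfw.
by rewrite mcoeff_outdom ?scale0r.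
Qed.

Lemma lext_is_linear h : linear (lext h).
Proof.
move=> k x y; pose D := (msupp x `|` msupp y)%fset.
have xD : (msupp x `<=` D)%fset by exact: fsubsetUl.
have yD : (msupp y `<=` D)%fset by exact: fsubsetUr.
have xyD : (msupp (k *: x + y) `<=` D)%fset.
  apply: fsubset_trans (msuppD_le _ _) _; apply: fsetSU; exact: msuppZ_le.
rewrite (lextEw _ xD) (lextEw _ yD) (lextEw _ xyD) scaler_sumr -big_split.
by apply: eq_bigr => w _ /=; rewrite mcoeffD mcoeffZ scalerDl scalerA.
Qed.

HB.instance Definition _ h :=
  GRing.isLinear.Build F {malg F[K]} V *:%R (lext h) (lext_is_linear h).

Lemma lextU h k : lext h << k >> = h k.
Proof.
rewrite (lextEw _ (msuppU_le : (_ `<=` [fset k])%fset)) big_seq_fset1.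
by rewrite mcoeffUU scale1r.
Qed.

Lemma eq_lext_supp h1 h2 f :
  (forall k, k \in msupp f -> h1 k = h2 k) -> lext h1 f = lext h2 f.
Proof. by move=> eqh; apply: eq_big_seq => k kf; rewrite eqh. Qed.

Lemma eq_lext h1 h2 f : h1 =1 h2 -> lext h1 f = lext h2 f.
Proof. by move=> eqh; apply: eq_lext_supp. Qed.

Lemma lext_eq0 h f : (forall k, k \in msupp f -> h k = 0) -> lext h f = 0.
Proof.
by move=> h0; apply: big1_seq => k /andP[_ kf]; rewrite h0 ?scaler0.
Qed.

Lemma lext_lin a h1 h2 f :
  lext (fun k => a *: h1 k + h2 k) f = a *: lext h1 f + lext h2 f.
Proof.
rewrite /lext scaler_sumr -big_split; apply: eq_bigr => w _ /=.
by rewrite scalerDr !scalerA mulrC.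
Qed.

Lemma lext_sumf (I : Type) (r : seq I) (P : pred I) (h : I -> K -> V) f :
  lext (fun k => \sum_(i <- r | P i) h i k) f =
  \sum_(i <- r | P i) lext (h i) f.
Proof.
rewrite /lext exchange_big; apply: eq_bigr => k _; by rewrite scaler_sumr.
Qed.

End LinearExtension.

Lemma malg_lextE (F : fieldType) (K : choiceType) (f : {malg F[K]}) :
  f = lext (fun k => << k >>) f.
Proof.
rewrite {1}[f]monalgE; apply: eq_bigr => w _; apply/malgP => v.
by rewrite mcoeffZ !mcoeffU mulr_natr.
Qed.

Lemma linear_lext (F : fieldType) (K : choiceType) (V W : lmodType F)
    (L : {linear V -> W}) (h : K -> V) f :
  L (lext h f) = lext (fun k => L (h k)) f.
Proof. by rewrite /lext linear_sum; apply: eq_bigr => k _; rewrite linearZ. Qed.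

Section LinearMaps.
Variables (F : fieldType) (K : choiceType) (W : lmodType F).

Lemma linearE_lext (L : {linear {malg F[K]} -> W}) f :
  L f = lext (fun k => L << k >>) f.
Proof. by rewrite {1}[f]malg_lextE linear_lext. Qed.

Lemma eq_linear_supp (L1 L2 : {linear {malg F[K]} -> W}) f :
  (forall k, k \in msupp f -> L1 << k >> = L2 << k >>) -> L1 f = L2 f.
Proof. by move=> e; rewrite linearE_lext (linearE_lext L2); apply: eq_lext_supp. Qed.

Lemma eq_linear (L1 L2 : {linear {malg F[K]} -> W}) :
  (forall k, L1 << k >> = L2 << k >>) -> L1 =1 L2.
Proof. by move=> e f; apply: eq_linear_supp. Qed.
End LinearMaps.

Lemma mcoeff_lext (F : fieldType) (K L : choiceType) (h : K -> {malg F[L]}) f l :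
  (lext h f)@_l = \sum_(k <- msupp f) f@_k * (h k)@_l.
Proof.
by rewrite /lext raddf_sum; apply: eq_bigr => k _; exact: mcoeffZ.
Qed.

Lemma msupp_neq0 (F : fieldType) (K : choiceType) (f : {malg F[K]}) :
  f <> 0 -> exists k, k \in msupp f.
Proof.
move=> f0; apply: contrapT => no; apply: f0; apply/malgP => k.
by rewrite mcoeff0 mcoeff_outdom //; apply/negP => kf; apply: no; exists k.
Qed.

Lemma mcoeff_sumU (F : fieldType) (L : choiceType) (s : seq L) l :
  (\sum_(t <- s) << t >> : {malg F[L]})@_l = (count_mem l s)%:R.
Proof.
rewrite raddf_sum /= -sum1_count natr_sum [RHS]big_mkcond.
by apply: eq_bigr => t _; rewrite mcoeffU /=; case: (t == l).
Qed.

Lemma msupp_sumU (F : fieldType) (L : choiceType) (s : seq L) l :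
  l \in msupp (\sum_(t <- s) << t >> : {malg F[L]}) -> l \in s.
Proof.
rewrite -mcoeff_neq0 mcoeff_sumU -has_pred1 has_count.
by case: (count _ _) => //; rewrite eqxx.
Qed.

Lemma msupp_lext (F : fieldType) (K L : choiceType) (h : K -> {malg F[L]}) f l :
  l \in msupp (lext h f) -> exists2 k, k \in msupp f & l \in msupp (h k).
Proof.
move=> lf; apply: contrapT => no.
move: lf; rewrite -mcoeff_neq0 mcoeff_lext big1_seq ?eqxx // => k /andP[_ kf].
rewrite (mcoeff_outdom (g := h k)) ?mulr0 //.
by apply/negP => lk; apply: no; exists k.
Qed.

(** * Graded pieces *)

Section GradedPieces.
Variables (F : fieldType) (K : choiceType) (dg : K -> nat).
Implicit Types f : {malg F[K]}.

Definition deg_le n f := forall k, k \in msupp f -> (dg k <= n)%N.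
Definition homog n f := forall k, k \in msupp f -> dg k = n.
Definition hcomp (n : nat) : {malg F[K]} -> {malg F[K]} :=
  lext (fun k => if dg k == n then << k >> else 0).

HB.instance Definition _ n := GRing.Linear.on (hcomp n).

Lemma mcoeff_hcomp n f k : (hcomp n f)@_k = if dg k == n then f@_k else 0.
Proof.
rewrite mcoeff_lext; have [kf|kf] := boolP (k \in msupp f); last first.
  rewrite (mcoeff_outdom kf) if_same big1_seq // => l /andP[_ lf].
  case: eqP; rewrite ?mcoeff0 ?mulr0 // mcoeffU.
  by case: eqP lf kf => [-> ->|]; rewrite ?mulr0n ?mulr0.
rewrite (bigD1_seq k) //= big1 ?addr0 => [|l].
  by case: eqP => _; rewrite ?mcoeff0 ?mulr0 // mcoeffUU mulr1.
by move/negPf=> lk; case: (dg l == n); rewrite ?mcoeff0 ?mulr0 // mcoeffU lk mulr0.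
Qed.

Lemma homog_hcomp n f : homog n (hcomp n f).
Proof.
by move=> k; rewrite -mcoeff_neq0 mcoeff_hcomp; case: (dg k =P n); rewrite ?eqxx.
Qed.

Lemma hcomp_homog n f : homog n f -> hcomp n f = f.
Proof.
move=> hf; apply/malgP => k; rewrite mcoeff_hcomp; case: (dg k =P n) => // nk.
by rewrite mcoeff_outdom //; apply/negP => /hf.
Qed.

Lemma msupp_hcomp n f k : k \in msupp (hcomp n f) -> k \in msupp f.
Proof. by rewrite -!mcoeff_neq0 mcoeff_hcomp; case: (dg k =P n); rewrite ?eqxx. Qed.

Lemma deg_leD n f g : deg_le n f -> deg_le n g -> deg_le n (f + g).
Proof.
by move=> hf hg k /(fsubsetP (msuppD_le _ _)); rewrite in_fsetU => /orP[/hf|/hg].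
Qed.

Lemma deg_leN n f : deg_le n f -> deg_le n (- f).
Proof. by move=> hf k; rewrite msuppN; apply: hf. Qed.

Lemma homog_deg_le n f : homog n f -> deg_le n f.
Proof. by move=> hf k /hf ->. Qed.

Lemma deg_le_ex f : exists n, deg_le n f.
Proof.
exists (\max_(k <- msupp f) dg k) => k kf; rewrite (big_rem k) //=.
exact: leq_maxl.
Qed.

Lemma top_degree f : f != 0 -> exists2 n, deg_le n f & hcomp n f != 0.
Proof.
move=> f0; have [n] := deg_le_ex f; elim: n => [|n IHn] hn.
  exists 0%N => //; rewrite hcomp_homog // => k /hn; lia.
have [hc0|] := eqVneq (hcomp n.+1 f) 0; last by exists n.+1.
apply: IHn => k kf; have := hn _ kf; rewrite leq_eqVlt.
case/orP=> [/eqP dk|]; last by lia.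
move: kf; rewrite -mcoeff_neq0; have := mcoeff_hcomp n.+1 f k.
by rewrite hc0 dk eqxx mcoeff0 => <-; rewrite eqxx.
Qed.

Lemma lext_hcomp (V : lmodType F) (h : K -> V) n f :
  lext h (hcomp n f) = lext (fun k => if dg k == n then h k else 0) f.
Proof.
rewrite /hcomp linear_lext; apply: eq_lext => k.
by case: (dg k =P n) => _ /=; rewrite ?lextU ?linear0.
Qed.

End GradedPieces.

(** * Bilinear extensions *)

Section Bilinear.
Variables (F : fieldType) (K1 K2 K3 : choiceType).
Implicit Types m : K1 -> K2 -> seq K3.

Definition bil m (a : {malg F[K1]}) (b : {malg F[K2]}) : {malg F[K3]} :=
  lext (fun x => lext (fun y => \sum_(z <- m x y) << z >>) b) a.

Lemma bil_linearl m b : linear (bil m ^~ b).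
Proof. by move=> k x y; apply: linearP. Qed.
Lemma bil_linearr m a : linear (bil m a).
Proof.
by move=> k x y; rewrite /bil -lext_lin; apply: eq_lext => u; apply: linearP.
Qed.
HB.instance Definition _ m a :=
  GRing.isLinear.Build F {malg F[K2]} {malg F[K3]} *:%R (bil m a) (bil_linearr m a).

(** The first argument is put last so that the linearity of bil in its first
argument can be registered as an instance. *)
Definition bilr m b a := bil m a b.
HB.instance Definition _ m b :=
  GRing.isLinear.Build F {malg F[K1]} {malg F[K3]} *:%R (bilr m b) (bil_linearl m b).

Lemma bilUU m x y : bil m << x >> << y >> = \sum_(z <- m x y) << z >>.
Proof. by rewrite /bil !lextU. Qed.

Lemma bil0l m b : bil m 0 b = 0.
Proof. exact: (linear0 (bilr m b)). Qed.

Lemma bilDl m a a' b : bil m (a + a') b = bil m a b + bil m a' b.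
Proof. exact: (linearD (bilr m b)). Qed.

Lemma bilZl m k a b : bil m (k *: a) b = k *: bil m a b.
Proof. exact: (linearZ_LR (bilr m b)). Qed.

Lemma bil_lextl (K : choiceType) m (h : K -> {malg F[K1]}) c b :
  bil m (lext h c) b = lext (fun k => bil m (h k) b) c.
Proof. exact: (linear_lext (bilr m b)). Qed.

Lemma bil_suml (I : Type) (r : seq I) m (h : I -> {malg F[K1]}) b :
  bil m (\sum_(i <- r) h i) b = \sum_(i <- r) bil m (h i) b.
Proof. exact: (linear_sum (bilr m b)). Qed.

Section Degrees.
Variables (d1 : K1 -> nat) (d2 : K2 -> nat) (d3 : K3 -> nat).

Lemma msupp_bil m a b z : z \in msupp (bil m a b) ->
  exists x y, [/\ x \in msupp a, y \in msupp b & z \in m x y].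
Proof.
case/msupp_lext => x xa /msupp_lext[y yb] /msupp_sumU zxy.
by exists x, y.
Qed.

(** Top components of a bilinear product that is only filtered: m' lists the
terms of m whose degree does not drop. The graded case is m' = m; the other
case of interest has shuffles for m'. *)
Lemma hcomp_bil m m' n n' a b :
  (forall x y z, z \in m x y -> (d3 z <= d1 x + d2 y)%N) ->
  (forall x y, \sum_(z <- m x y | (d3 z == d1 x + d2 y)%N) << z >> =
     \sum_(z <- m' x y) << z >> :> {malg F[K3]}) ->
  deg_le d1 n a -> deg_le d2 n' b ->
  hcomp d3 (n + n') (bil m a b) = bil m' (hcomp d1 n a) (hcomp d2 n' b).
Proof.
move=> dm em ha hb; rewrite /bil linear_lext lext_hcomp; apply: eq_lext_supp => x xa.
rewrite linear_lext lext_hcomp.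
transitivity (lext (fun y =>
   if (d1 x == n) && (d2 y == n') then \sum_(z <- m' x y) << z >> else 0
     : {malg F[K3]}) b).
  apply: eq_lext_supp => y yb; rewrite linear_sum /=.
  have [/eqP e1|ne] /= := boolP ((d1 x == n) && (d2 y == n')).
    have [e2 e3] : d1 x = n /\ d2 y = n' by case/andP: (elimT eqP e1) => /eqP-> /eqP->.
    rewrite -em -e2 -e3 [RHS]big_mkcond; apply: eq_bigr => z _.
    by rewrite /hcomp lextU.
  rewrite big1_seq // => z /andP[_ zm]; rewrite /hcomp lextU; case: eqP => // e.
  have := dm _ _ _ zm; have := ha _ xa; have := hb _ yb.
  by move/nandP: ne => [] /eqP; lia.
by case: eqP => //= _; rewrite lext_eq0.
Qed.

Lemma deg_le_bil m n n' a b :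
  (forall x y z, z \in m x y -> (d3 z <= d1 x + d2 y)%N) ->
  deg_le d1 n a -> deg_le d2 n' b -> deg_le d3 (n + n') (bil m a b).
Proof.
move=> dm ha hb z /msupp_bil[x [y [/ha xa /hb yb /dm]]]; lia.
Qed.
End Degrees.
End Bilinear.

Lemma eq_bilinear (F : fieldType) (K1 K2 : choiceType) (V : lmodType F)
    (B1 B2 : {malg F[K1]} -> {malg F[K2]} -> V) :
  (forall b, linear (B1 ^~ b)) -> (forall a, linear (B1 a)) ->
  (forall b, linear (B2 ^~ b)) -> (forall a, linear (B2 a)) ->
  (forall x y, B1 << x >> << y >> = B2 << x >> << y >>) ->
  forall a b, B1 a b = B2 a b.
Proof.
move=> l1 r1 l2 r2 e a b.
pose L (B : {malg F[K1]} -> V) (lB : linear B) :=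
  HB.pack_for {linear {malg F[K1]} -> V} B (GRing.isLinear.Build F _ _ _ B lB).
pose R (B : {malg F[K2]} -> V) (lB : linear B) :=
  HB.pack_for {linear {malg F[K2]} -> V} B (GRing.isLinear.Build F _ _ _ B lB).
refine (@eq_linear _ _ _ (L _ (l1 b)) (L _ (l2 b)) _ a) => x.
refine (@eq_linear _ _ _ (R _ (r1 << x >>)) (R _ (r2 << x >>)) _ b) => y.
exact: e.
Qed.

(** * Tensors *)

Lemma mem_splits (T : eqType) (s : seq T) p : p \in splits s -> p.1 ++ p.2 = s.
Proof. by case/mapP => i _ ->; rewrite cat_take_drop. Qed.

Lemma splits_rcons (T : Type) (s : seq T) :
  splits s = rcons [seq (take i s, drop i s) | i <- iota 0 (size s)] (s, [::]).
Proof.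
by rewrite /splits -addn1 iotaD map_cat /= take_size drop_size cats1.
Qed.

Local Opaque splits.

Section Tensors.
Variables (F : fieldType) (X : choiceType).
Local Notation A := {malg F[bword X]}.
Local Notation H := {malg F[seq (bword X)]}.

Definition word_tens (s : seq (bword X)) : H := << s >>.
(** The pure tensor f_1 f_2 ... f_n. *)
Definition tens (fs : seq (Br F X)) : H := mlext word_tens fs.

Lemma tens_multilinear : multilinear tens.
Proof. exact: mlext_multilinear. Qed.

Lemma tens_word s : tens (map (@Br_word F X) s) = << s >>.
Proof. exact: mlext_word. Qed.

Lemma linear_mlext (V W : lmodType F) (L : {linear V -> W}) h (fs : seq (Br F X)) :
  L (mlext h fs) = mlext (fun s => L (h s)) fs.
Proof.
elim: fs h => [//|f fs IHfs] h /=.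
rewrite -[LHS]/(L (lext _ f)) linear_lext.
by apply: eq_lext => w; exact: IHfs.
Qed.

Definition act (a : H) (f : A) : A := bil (@wbrace X) a f.
Definition mul (a b : H) : H := bil (insertions (@wbrace X)) a b.

Lemma Br_brace_act (s : seq (Br F X)) (f : A) : Br_brace s f = act (tens s) f.
Proof.
rewrite /tens /act -[RHS]/(bilr _ f _) linear_mlext.
by apply: mlext_eq => vs /=; rewrite /bilr /bil lextU.
Qed.

Lemma act_mul a b f : act (mul a b) f = act a (act b f).
Proof.
move: a b; apply: eq_bilinear => [b|a|b|a|x y].
- by move=> k x y; rewrite /act /mul bilDl bilZl bilDl bilZl.
- by move=> k x y; rewrite /act /mul linearP bilDl bilZl.
- by move=> k x y; rewrite /act bilDl bilZl.
- by move=> k x y; rewrite /act bilDl bilZl linearP.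
refine (@eq_linear F (bword X) A
  (bil (@wbrace X) (bil (insertions (@wbrace X)) (<< x >> : H) << y >>))
  (bil (@wbrace X) (<< x >> : H) \o bil (@wbrace X) (<< y >> : H)) _ f) => w /=.
rewrite !bilUU linear_sum bil_suml.
under eq_bigr do rewrite /= bilUU.
under [RHS]eq_bigr do rewrite /= bilUU.
by rewrite big_wbraceA.
Qed.

Lemma act1 f : act << [::] >> f = f.
Proof.
rewrite /act /bil lextU [RHS]malg_lextE; apply: eq_lext => w.
by rewrite wbrace_nil big_seq1.
Qed.
End Tensors.

(** * Tensor powers of a linear map *)

Section InsertionSums.
Variables (F : fieldType) (A V : lmodType F) (K : Type).
Variables (op : seq K -> K -> seq K) (br : seq A -> A -> A) (e : K -> A).

(** A map e from words to A that turns the word operation op into the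
operation br turns insertions of words into insertions of vectors. Words under
wbrace, their values under an evaluation morphism and, with the operation
rigid, arbitrary vectors are all of this kind. *)
Lemma big_insertions_image (h : seq A -> V) vs us : multilinear h ->
  foldr (fun u => and (forall s, br (map e s) (e u) = \sum_(t <- op s u) e t))
    True us ->
  \sum_(l <- insertions (fun s b => [:: br s b]) (map e vs) (map e us)) h l =
  \sum_(l <- insertions op vs us) h (map e l).
Proof.
elim: us vs h => [|u us IHus] vs h hP /=; first by rewrite !big_seq1.
case=> Hu Hus; rewrite big_ins_cons big_insertions_cons splits_map big_map.
apply: eq_bigr => p _ /=; rewrite splits_map big_map.
apply: eq_bigr => q _ /=.
rewrite (IHus _ (fun r => h (_ ++ _ :: r))) //; last exact: multilinear_ctx.
rewrite exchange_big; apply: eq_bigr => r _; rewrite Hu.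
rewrite (Defs.linear_sum (h := fun g => h (_ ++ g :: _))); last exact: hP.
by apply: eq_bigr => w _; rewrite map_cat.
Qed.
End InsertionSums.

Lemma foldr_and_all (K : Type) (P : K -> Prop) s :
  (forall u, P u) -> foldr (fun u => and (P u)) True s.
Proof. by move=> PP; elim: s => //= u s IHs; split. Qed.

Section TensorProducts.
Variables (F : fieldType) (X : choiceType).
Local Notation H := {malg F[seq (bword X)]}.
Variables (op : seq (bword X) -> bword X -> seq (bword X)).
Variables (br : seq (Br F X) -> Br F X -> Br F X).
Hypothesis brl : forall a s t k x y,
  br (s ++ (k *: x + y) :: t) a = k *: br (s ++ x :: t) a + br (s ++ y :: t) a.
Hypothesis brr : forall s k x y, br s (k *: x + y) = k *: br s x + br s y.
Hypothesis br_word : forall s w,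
  br (map (@Br_word F X) s) (Br_word F w) = \sum_(t <- op s w) Br_word F t.

(** The product of two pure tensors is computed by the same insertions as on
forests: both sides are multilinear and agree on words. *)
Lemma bil_insertions_tens (fs gs : seq (Br F X)) :
  bil (insertions op) (tens fs) (tens gs) =
  \sum_(l <- insertions (fun s b => [:: br s b]) fs gs) tens l.
Proof.
move: fs; apply: multilinear_eq => [s t k x y||us].
- by rewrite tens_multilinear bilDl bilZl.
- exact: (multilinear_insl brl gs (@tens_multilinear F X)).
move: gs; apply: multilinear_eq => [s t k x y||ts].
- by rewrite tens_multilinear linearP.
- exact: (multilinear_insr brr _ (@tens_multilinear F X)).
rewrite (big_insertions_image (op := op)); last exact: foldr_and_all.
  rewrite !tens_word bilUU; by under [RHS]eq_bigr do rewrite tens_word.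
exact: tens_multilinear.
Qed.

Variables (K : choiceType) (opK : seq K -> K -> seq K) (e : K -> Br F X).

(** Tensor power of the linear map with values e. *)
Definition tens_map : {malg F[seq K]} -> H := lext (fun s => tens (map e s)).
HB.instance Definition _ := GRing.Linear.on tens_map.

Lemma tens_mapU s : tens_map << s >> = tens (map e s).
Proof. exact: lextU. Qed.

Hypothesis br_e : forall s u, br (map e s) (e u) = \sum_(t <- opK s u) e t.

Lemma tens_map_bil a b :
  tens_map (bil (insertions opK) a b) = bil (insertions op) (tens_map a) (tens_map b).
Proof.
move: a b; apply: eq_bilinear => [b k x y|a k x y|b k x y|a k x y|x y].
- by rewrite bilDl bilZl linearP.
- by rewrite !linearP.
- by rewrite linearP bilDl bilZl.
- by rewrite !linearP.
rewrite bilUU linear_sum !tens_mapU bil_insertions_tens.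
under eq_bigr do rewrite /= tens_mapU.
rewrite (big_insertions_image (op := opK)) //; first exact: tens_multilinear.
exact: foldr_and_all.
Qed.
End TensorProducts.

(** * Weights of words and forests *)

Section Weights.
Variables (X : choiceType) (d : X -> nat).

Fixpoint wt (w : bword X) : nat :=
  let: BNode x us := w in (d x + sumn (map wt us))%N.

Definition fwt (s : seq (bword X)) : nat := sumn (map wt s).

Lemma fwt_cons u s : fwt (u :: s) = (wt u + fwt s)%N. Proof. by []. Qed.

Lemma fwt_cat s t : fwt (s ++ t) = (fwt s + fwt t)%N.
Proof. by rewrite /fwt map_cat sumn_cat. Qed.

Hypothesis d_gt0 : forall x, (0 < d x)%N.

Lemma wt_gt0 w : (0 < wt w)%N.
Proof. by case: w => x us /=; rewrite addn_gt0 d_gt0. Qed.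

Lemma fwt_eq0 s : (fwt s == 0%N) = (s == [::]).
Proof. by case: s => //= u s; rewrite fwt_cons addn_eq0 eqn0Ngt wt_gt0. Qed.
End Weights.

Lemma mem_insertions_cons (T : eqType) (op : seq T -> T -> seq T) vs u us l :
  l \in insertions op vs (u :: us) ->
  exists p q r w t, [/\ vs = p ++ q ++ r, l = p ++ w :: t, w \in op q u &
    t \in insertions op r us].
Proof.
rewrite insertions_cons => /flatten_mapP[p /mem_splits ep].
case/flatten_mapP => q /mem_splits eq /allpairsP[[w t] /= [wq tq ->]].
by exists p.1, q.1, q.2, w, t; rewrite eq ep.
Qed.

Lemma size_insertions (T : eqType) (op : seq T -> T -> seq T) vs us l :
  l \in insertions op vs us -> (size l <= size vs + size us)%N.
Proof.
elim: us vs l => [|u us IHus] vs l; first by rewrite inE => /eqP ->; rewrite addn0.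
case/mem_insertions_cons => p [q [r [w [t [-> -> _ /IHus]]]]].
rewrite !size_cat /=; lia.
Qed.

Lemma fwt_insertions (X : choiceType) (d : X -> nat) op vs us l :
  foldr (fun u => and (forall s t, t \in op s u -> wt d t = fwt d s + wt d u)%N)
    True us ->
  l \in insertions op vs us -> fwt d l = (fwt d vs + fwt d us)%N.
Proof.
elim: us vs l => [|u us IHus] vs l.
  by move=> _; rewrite inE => /eqP ->; rewrite addn0.
case=> Hu /IHus{}IHus.
case/mem_insertions_cons => p [q [r [w [t [-> -> /Hu wE /IHus tE]]]]].
rewrite !fwt_cat !fwt_cons wE tE; lia.
Qed.

Lemma wt_wbrace (X : choiceType) (d : X -> nat) vs w t :
  t \in wbrace vs w -> wt d t = (fwt d vs + wt d w)%N.
Proof.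
elim/bword_nested_ind: w vs t => x us IH vs t /mapP[l lI ->].
rewrite /= -/(fwt d l) -/(fwt d us) (fwt_insertions _ lI); first by lia.
by elim: us IH {lI} => //= u us IHus [Hu /IHus]; split.
Qed.

Lemma fwt_mul (X : choiceType) (d : X -> nat) vs us l :
  l \in insertions (@wbrace X) vs us -> fwt d l = (fwt d vs + fwt d us)%N.
Proof.
by apply: fwt_insertions; apply: foldr_and_all => u s t; apply: wt_wbrace.
Qed.

(** * Leading words of grafts *)

Section Attach.
Variable X : choiceType.
Implicit Types (w v t : bword X) (z s : seq (bword X)).

Definition children w := let: BNode _ us := w in us.

Fixpoint attach z w : bword X :=
  let: BNode x us := w in BNode x (if us is u :: us' then attach z u :: us' else z).

(** The depth of the leftmost leaf and the number of children of its parent,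
compared lexicographically. *)
Fixpoint lrank w : nat * nat :=
  let: BNode x us := w in
  if us is u :: _ then
    if u is BNode _ [::] then (1%N, size us) else ((lrank u).1.+1, (lrank u).2)
  else (0%N, 0%N).

Definition rank_lt (p q : nat * nat) :=
  (p.1 < q.1)%N || (p.1 == q.1) && (p.2 < q.2)%N.

Definition word_lt v w := rank_lt (lrank v) (lrank w).

Lemma word_lt_irr : irreflexive word_lt.
Proof. by move=> v; rewrite /word_lt /rank_lt !ltnn andbF. Qed.

Lemma word_lt_trans : transitive word_lt.
Proof. by move=> v u w; rewrite /word_lt /rank_lt; lia. Qed.

Lemma word_lt_ind (P : bword X -> Prop) :
  (forall w, (forall v, word_lt v w -> P v) -> P w) -> forall w, P w.
Proof.
move=> IH w; have [m] := ubnP (lrank w).1; elim: m w => // m IHm w mw.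
have [n] := ubnP (lrank w).2; elim: n w mw => // n IHn w mw nw.
apply: IH => v; rewrite /word_lt /rank_lt => /orP[vw|/andP[/eqP vw1 vw2]].
  by apply: IHm; lia.
by apply: IHn; lia.
Qed.

Definition leaf_first z := if z is BNode _ [::] :: _ then true else false.

Lemma lrank_cons1 x u us : (lrank (BNode x (u :: us))).1 = (lrank u).1.+1.
Proof. by case: u => y [|v vs]. Qed.

Lemma lrank_cons2 x u us : (lrank (BNode x (u :: us))).1 != 1%N ->
  (lrank (BNode x (u :: us))).2 = (lrank u).2.
Proof. by case: u => y [|v vs]. Qed.

Lemma lrank_attach z w : leaf_first z ->
  lrank (attach z w) = ((lrank w).1.+1, size z).
Proof.
move=> zP; elim/bword_nested_ind: w => x [_|u us [IHu _]].
  by case: z zP => [|[y [|? ?]] z].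
rewrite /attach -/attach.
have E : lrank (BNode x (attach z u :: us)) =
    ((lrank (attach z u)).1.+1, (lrank (attach z u)).2).
  by case: u {IHu} => y [|? ?] //=; case: z zP.
by rewrite E IHu lrank_cons1.
Qed.

Lemma attach_children z w : leaf_first z -> children (attach z w) != [::].
Proof. by case: w => y [|? ?] //=; case: z. Qed.

Lemma attach_inj z z' w w' : leaf_first z -> leaf_first z' ->
  attach z w = attach z' w' -> z = z' /\ w = w'.
Proof.
move=> zP z'P; elim/bword_nested_ind: w w' => x us IH [x' us'].
case: us IH => [_|u us [IHu _]]; case: us' => [|u' us'] /=.
- by case=> -> ->.
- case=> _ ez; move: zP (attach_children u' z'P); rewrite ez /=.
  by case: (attach z' u') => ? [].
- case=> _ ez; move: z'P (attach_children u zP); rewrite -ez /=.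
  by case: (attach z u) => ? [].
- by case=> -> /IHu[-> ->] ->.
Qed.

Lemma attach_surj v : children v != [::] ->
  exists z w, leaf_first z /\ v = attach z w.
Proof.
elim/bword_nested_ind: v => x [|u us] //= [IHu _] _.
have [e|/IHu[z [w [zP uE]]]] := eqVneq (children u) [::].
  by exists (u :: us), (BNode x [::]); case: u e {IHu} => y [|? ?] //=.
by exists z, (BNode x (w :: us)); rewrite uE.
Qed.

Lemma leaf_first_take z i : leaf_first z -> take i z != [::] -> leaf_first (take i z).
Proof. by case: z i => [|[y [|? ?]] z] // [|i]. Qed.

Local Arguments lrank : simpl never.

(** Induction along the leftmost branch. If a nonempty part of z stays at the
level of a child u of the root, on its left, the leftmost leaf has depth 1;
otherwise a prefix q of z is inserted in u, and by induction the depth is at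
most that of grafting q on the leftmost leaf, which then has at most as many
siblings as q has trees. *)
Lemma wbrace_attach z w : leaf_first z ->
  exists L, perm_eq (wbrace z w) (attach z w :: L) /\
    forall t, t \in L -> word_lt t (attach z w).
Proof.
elim/bword_nested_ind: w z => x [_|u us [IHu _]] z zP; first by exists [::].
have [L' [pL' ltL']] := IHu _ zP.
(* Either some trees of z stay on the left of u (these terms form R), or a prefix
   of z is inserted in u: a proper one (the pairs in L2) or all of z. *)
pose G (q : seq (bword X) * seq (bword X)) :=
  [seq w :: r | w <- wbrace q.1 u, r <- insertions (@wbrace X) q.2 us].
pose L2 := [seq (take i z, drop i z) | i <- iota 0 (size z)].
have [R insE ltR] : exists2 R, insertions (@wbrace X) z (u :: us) =
    flatten [seq G q | q <- splits z] ++ R &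
    forall l, l \in R -> exists y l', l = BNode y [::] :: l'.
  rewrite insertions_cons.
  case: z zP {L' pL' ltL' L2} => [|[y [|? ?]] z] // _.
  exists (flatten [seq flatten [seq [seq p.1 ++ w :: r | w <- wbrace q.1 u,
      r <- insertions (@wbrace X) q.2 us] | q <- splits p.2]
    | p <- [seq (BNode y [::] :: p.1, p.2) | p <- splits z]]).
    by rewrite {1}splits_cons.
  move=> l /flatten_mapP[p /mapP[p' _ ->]] /flatten_mapP[q _].
  by case/allpairsP => wr [_ _ ->] /=; do 2 eexists.
have splE : flatten [seq G q | q <- splits z] =
    flatten [seq G q | q <- L2] ++ [seq w :: us | w <- wbrace z u].
  rewrite splits_rcons map_rcons flatten_rcons; congr (_ ++ _).
  rewrite /G /= (_ : insertions _ _ _ = [:: us]) ?allpairs1r //.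
  have := wbrace_nil (BNode x us); rewrite /= .
  by case: (insertions _ _ _) => [|a [|? ?]] //= [->].
exists [seq BNode x l | l <- flatten [seq G q | q <- L2] ++
    [seq w :: us | w <- L'] ++ R]; split.
  have -> : wbrace z (BNode x (u :: us)) =
    [seq BNode x l | l <- insertions (@wbrace X) z (u :: us)] by [].
  have -> : attach z (BNode x (u :: us)) = BNode x (attach z u :: us) by [].
  rewrite -map_cons; apply: perm_map; rewrite insE splE -catA.
  rewrite -cat1s perm_sym perm_catCA perm_cat2l perm_sym catA perm_cat2r cat1s.
  by rewrite -[_ :: _]/(map (fun w => w :: us) (_ :: _)); apply: perm_map.
have rkE : lrank (attach z (BNode x (u :: us))) = ((lrank u).1.+2, size z).
  by rewrite lrank_attach // lrank_cons1.
move=> t /mapP[l + ->]; rewrite /word_lt rkE !mem_cat.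
case/or3P=> [|/mapP[w wL' ->]|/ltR[y [l' ->]]].
- case/flatten_mapP => q /mapP[i]; rewrite mem_iota add0n => /andP[_ iz] ->.
  case/allpairsP => -[w r] /= [wq _ ->].
  have [z'0|z'P] := eqVneq (take i z) [::].
    move: wq; rewrite z'0 wbrace_nil inE => /eqP ->.
    by rewrite /rank_lt lrank_cons1 /=; lia.
  have z'lf := leaf_first_take zP z'P.
  have [L [pL ltL]] := IHu _ z'lf.
  have: rank_lt (lrank w) (lrank (attach (take i z) u)) \/ w = attach (take i z) u.
    move: wq; rewrite (perm_mem pL) inE => /orP[/eqP ->|/ltL]; first by right.
    by left.
  have szi : (size (take i z) < size z)%N by rewrite size_take iz.
  rewrite lrank_attach // => -[|->].
    have := @lrank_cons2 x w r; rewrite /rank_lt lrank_cons1 /=; lia.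
  have := @lrank_cons2 x (attach (take i z) u) r.
  by rewrite /rank_lt lrank_cons1 lrank_attach //=; lia.
- have := ltL' _ wL'; rewrite /word_lt lrank_attach // /rank_lt.
  by have := @lrank_cons2 x w us; rewrite lrank_cons1 /=; lia.
by rewrite /rank_lt lrank_cons1 /=.
Qed.
End Attach.

(** * Leading terms *)

Lemma maximal_ex (T : eqType) (lt : rel T) (s : seq T) :
  irreflexive lt -> transitive lt -> s != [::] ->
  exists2 m, m \in s & forall k, k \in s -> ~~ lt m k.
Proof.
move=> irr tr; elim: s => // a s IHs _.
have [s0|/IHs[m ms mP]] := eqVneq s [::].
  by exists a; rewrite ?s0 ?inE // => k; rewrite inE => /eqP ->; rewrite irr.
have [ma|ma] := boolP (lt m a); last first.
  by exists m => [|k]; rewrite inE ?ms ?orbT // => /orP[/eqP ->|/mP].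
exists a => [|k]; rewrite inE ?eqxx // => /orP[/eqP ->|/mP]; first by rewrite irr.
by apply: contra => /(tr _ _ _ ma).
Qed.

(** A family whose leading terms are pairwise distinct is linearly
independent: in a vanishing combination, a maximal leading term cannot be
cancelled. *)
Lemma lext_leading_inj (F : fieldType) (K L : choiceType) (lt : rel L)
    (e : K -> {malg F[L]}) (ld : K -> L) (E : {malg F[K]}) :
  irreflexive lt -> transitive lt ->
  (forall k, k \in msupp E -> (e k)@_(ld k) != 0) ->
  (forall k l, k \in msupp E -> l \in msupp (e k) -> l = ld k \/ lt l (ld k)) ->
  {in msupp E &, injective ld} -> lext e E = 0 -> E = 0.
Proof.
move=> irr tr e0 elt ldI eE0; apply: contrapT => /msupp_neq0[k1 k1E].
have /(maximal_ex irr tr)[_ /mapP[k kE ->] kmax] :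
    [seq ld k | k <- msupp E] != [::].
  by apply: contraL (map_f ld k1E) => /eqP ->.
have := mcoeff_lext e E (ld k); rewrite eE0 mcoeff0 (bigD1_seq k) //=.
rewrite big1_seq ?addr0 => [/esym/eqP|l /andP[lk lE]].
  by rewrite mulf_eq0 (negPf (e0 _ kE)) orbF mcoeff_eq0 kE.
have [kl|/mcoeff_outdom ->] := boolP (ld k \in msupp (e l)); last by rewrite mulr0.
have [/(ldI _ _ kE lE) kl'|] := elt _ _ lE kl; first by rewrite kl' eqxx in lk.
by rewrite (negPf (kmax _ (map_f _ lE))).
Qed.

Section FreeActions.
Variables (F : fieldType) (X : choiceType) (d : X -> nat).
Hypothesis d_gt0 : forall x, (0 < d x)%N.
Local Notation A := {malg F[bword X]}.
Local Notation H := {malg F[seq (bword X)]}.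
Local Notation FF := {malg F[(seq (bword X) * seq (bword X))%type]}.
Local Notation FW := {malg F[(seq (bword X) * bword X)%type]}.

(** The right ideal generated by the leaf-first forests is free on them, also
when acting on A. *)
Lemma leaf_first_act_inj (E : FW) :
  (forall p, p \in msupp E -> leaf_first p.1) ->
  lext (fun p => \sum_(t <- wbrace p.1 p.2) << t >> : A) E = 0 -> E = 0.
Proof.
move=> EP; apply: (lext_leading_inj (lt := @word_lt X)
    (ld := fun p => attach p.1 p.2)) => [||p pE|p l pE|p q pE qE].
- exact: word_lt_irr.
- exact: word_lt_trans.
- have [L [/permP pL ltL]] := wbrace_attach p.2 (EP _ pE).
  rewrite mcoeff_sumU pL /= eqxx (count_memPn _) ?oner_eq0 //.
  by apply/negP => /ltL; rewrite word_lt_irr.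
- have [L [/perm_mem pL ltL]] := wbrace_attach p.2 (EP _ pE).
  by move/msupp_sumU; rewrite pL inE => /orP[/eqP ->|/ltL]; [left|right].
move/(attach_inj (EP _ pE) (EP _ qE)).
by case: p q {pE qE} => [z w] [z' w'] /= [-> ->].
Qed.

(** The leaf-first forests generate the augmentation ideal as a right ideal:
the forest G is the leading term of some z*c, and the other terms have smaller
rank. *)
Lemma forest_decomposition (G : seq (bword X)) : G != [::] ->
  exists D : FF,
    (forall p, p \in msupp D -> leaf_first p.1 /\
       (fwt d p.1 + fwt d p.2 = fwt d G)%N) /\
    lext (fun p => mul << p.1 >> << p.2 >> : H) D = << G >>.
Proof.
(* G is seen as the list of children of a word with an arbitrary root label. *)
case: G => // u us _; pose x := let: BNode x _ := u in x.
have : children (BNode x (u :: us)) != [::] by [].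
rewrite -[u :: us]/(children (BNode x (u :: us))).
move: (BNode x (u :: us)) => {u us x} v; elim/word_lt_ind: v => v IH v0.
have [z [w [zP vE]]] := attach_surj v0; case: w vE => x c vE.
have [L [pL ltL]] := wbrace_attach (BNode x c) zP.
have inL : perm_eq (insertions (@wbrace X) z c) (children v :: map (@children X) L).
  have := perm_map (@children X) pL; rewrite -vE /= -map_comp.
  by rewrite (eq_map (g := id)) ?map_id.
have wE l : l \in children v :: map (@children X) L ->
    fwt d l = (fwt d z + fwt d c)%N by rewrite -(perm_mem inL) => /fwt_mul.
have vwE := wE _ (mem_head _ _).
have : forall t, exists D : FF, t \in L ->
   (forall p, p \in msupp D -> leaf_first p.1 /\
       (fwt d p.1 + fwt d p.2 = fwt d (children v))%N) /\
    lext (fun p => mul << p.1 >> << p.2 >> : H) D = << children t >>.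
  move=> t; have [tL|] := boolP (t \in L); last by exists 0.
  have tE : fwt d (children t) = fwt d (children v).
    by rewrite vwE wE // inE map_f ?orbT.
  have t0 : children t != [::] by rewrite -(fwt_eq0 d_gt0) tE fwt_eq0.
  have [|D] := IH t _ t0; first by rewrite vE ltL.
  by rewrite tE; exists D.
case/choice => Dt DtP; exists (<< (z, c) >> - \sum_(t <- L) Dt t); split => [p|].
  move/(fsubsetP (msuppB_le _ _)); rewrite in_fsetU => /orP[].
    by move/(fsubsetP msuppU_le); rewrite in_fset1 => /eqP ->; rewrite vwE.
  have: forall t, t \in L -> forall p, p \in msupp (Dt t) -> leaf_first p.1 /\
       (fwt d p.1 + fwt d p.2 = fwt d (children v))%N by move=> t /DtP[].
  elim: (L) => [|t L' IHL] hL; first by rewrite big_nil msupp0.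
  rewrite big_cons => /(fsubsetP (msuppD_le _ _)); rewrite in_fsetU => /orP[].
    by apply: hL; rewrite mem_head.
  by apply: IHL => t' t'L; apply: hL; rewrite inE t'L orbT.
rewrite linearB /= lextU /mul bilUU /= (perm_big _ inL) /= big_cons big_map.
rewrite [X in _ - X](_ : _ = \sum_(t <- L) << children t >>) ?addrK //.
by rewrite (linear_sum (lext _)); apply: eq_big_seq => t /DtP[].
Qed.

Lemma decomposition (a : H) : (forall G, G \in msupp a -> G != [::]) ->
  exists D : FF,
    (forall p, p \in msupp D -> leaf_first p.1 /\
       exists2 G, G \in msupp a & (fwt d p.1 + fwt d p.2 = fwt d G)%N) /\
    lext (fun p => mul << p.1 >> << p.2 >> : H) D = a.
Proof.
move=> a0; have : forall G, exists D : FF,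
    G \in msupp a ->
    (forall p, p \in msupp D -> leaf_first p.1 /\
       (fwt d p.1 + fwt d p.2 = fwt d G)%N) /\
    lext (fun p => mul << p.1 >> << p.2 >> : H) D = << G >>.
  move=> G; have [Ga|] := boolP (G \in msupp a); last by exists 0.
  by have [D DP] := forest_decomposition (a0 _ Ga); exists D.
case/choice => D DP; exists (lext D a); split=> [p /msupp_lext[G Ga]|].
  by have [DGP _] := DP _ Ga; case/DGP => ? ?; split=> //; exists G.
rewrite linear_lext [RHS]malg_lextE; apply: eq_lext_supp => G Ga.
by have [_] := DP _ Ga.
Qed.

Section Peeling.
Variables (I : finType) (f : I -> A) (e : I -> nat).

(** The shift k keeps track of the weight already removed from the
coefficients, whose initial weights are the e i. *)
Definition homog_relation k (a : I -> H) :=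
  (forall i G, G \in msupp (a i) -> (fwt d G + k = e i)%N) /\
  \sum_i act (a i) (f i) = 0.

(** Since no coefficient has a constant term, each a_i is a sum over
leaf-first z of z*a_i^z, and freeness turns the relation into one relation
between the a_i^z for each z. *)
Lemma peel k a i0 : homog_relation k a -> a i0 != 0 ->
  (forall i, e i = k -> a i = 0) ->
  exists b k' i1, [/\ (k < k')%N, homog_relation k' b & b i1 != 0].
Proof.
case=> aE a0 ai0 ak.
have : forall i, exists D : FF,
    (forall p, p \in msupp D -> leaf_first p.1 /\
       (fwt d p.1 + fwt d p.2 + k = e i)%N) /\
    lext (fun p => mul << p.1 >> << p.2 >> : H) D = a i.
  move=> i; have [|D [DP DE]] := @decomposition (a i).
    move=> G Ga; apply/eqP => G0; have := aE _ _ Ga; rewrite G0 add0n => /esym/ak ai.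
    by move: Ga; rewrite ai msupp0.
  by exists D; split=> // p /DP[? [G /aE + ->]].
case/choice => D DP.
(* E lists the coefficients of the z acting on w, for z leaf-first and w a word. *)
pose E := \sum_i lext (fun p => lext (fun w => << (p.1, w) >>)
  (act << p.2 >> (f i)) : FW) (D i).
have E0 : E = 0.
  apply: leaf_first_act_inj => [p|].
    rewrite /E; elim/big_ind: _ => [|x y IHx IHy|i _]; first by rewrite msupp0.
      by move/(fsubsetP (msuppD_le _ _)); rewrite in_fsetU => /orP[].
    case/msupp_lext => q qD /msupp_lext[w _].
    move/(fsubsetP msuppU_le); rewrite in_fset1 => /eqP -> /=.
    by case: (DP i) => /(_ q qD)[].
  rewrite linear_sum -[RHS]a0; apply: eq_bigr => i _ /=.
  rewrite linear_lext; case: (DP i) => _ <-.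
  rewrite /act bil_lextl; apply: eq_lext => p.
  rewrite -[RHS]/(act (mul << p.1 >> << p.2 >>) (f i)) act_mul /act.
  rewrite linear_lext [RHS]linearE_lext.
  by apply: eq_lext => w /=; rewrite lextU bilUU.
have [p0 p0D] : exists p, p \in msupp (D i0).
  apply: msupp_neq0 => D0; case/eqP: ai0; have [_ <-] := DP i0.
  by rewrite D0 linear0.
exists (fun i => lext (fun p => if p.1 == p0.1 then << p.2 >> else 0) (D i)).
have [DP0 _] := DP i0; have [p0lf p0E] := DP0 _ p0D.
exists (fwt d p0.1 + k)%N, i0; split.
- rewrite -[X in (X < _)%N]add0n ltn_add2r lt0n fwt_eq0 //.
  by case: (p0.1) p0lf.
- split=> [i G /msupp_lext[p pD]|].
    case: eqP => [pp0|_]; last by rewrite msupp0.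
    move/(fsubsetP msuppU_le); rewrite in_fset1 => /eqP ->.
    have [/(_ _ pD)[_ <-] _] := DP i; rewrite pp0; lia.
  pose L : FW -> A :=
    lext (fun q => if q.1 == p0.1 then << q.2 >> else 0).
  transitivity (L E); last by rewrite E0 /L linear0.
  rewrite /L /E linear_sum; apply: eq_bigr => i _ /=.
  rewrite linear_lext /act bil_lextl; apply: eq_lext => p.
  rewrite linear_lext; case: (p.1 =P p0.1) => pp0.
    rewrite [LHS]malg_lextE; apply: eq_lext => w.
    by rewrite /= lextU /= pp0 eqxx.
  rewrite bil0l lext_eq0 // => w _; rewrite /= lextU /=.
  by case: eqP.
rewrite -mcoeff_neq0 in p0D; apply: contra p0D => /eqP/(congr1 (mcoeff p0.2)).
rewrite mcoeff0 mcoeff_lext => e0; apply/eqP; rewrite -[RHS]e0.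
have [p0S|p0N] := boolP (p0 \in msupp (D i0)); last first.
  rewrite (mcoeff_outdom p0N) big1_seq // => p /andP[_ pD].
  case: (p.1 =P p0.1) => p1; rewrite ?mcoeff0 ?mulr0 // mcoeffU.
  case: (p.2 =P p0.2) => p2; rewrite ?mulr0 //.
  by rewrite (surjective_pairing p0) -p1 -p2 -surjective_pairing pD in p0N.
rewrite (bigD1_seq p0) //= eqxx mcoeffUU mulr1 big1 ?addr0 // => p pp0.
case: (p.1 =P p0.1) => p1; rewrite ?mcoeff0 ?mulr0 // mcoeffU.
case: (p.2 =P p0.2) => p2; rewrite ?mulr0 //.
by rewrite (surjective_pairing p0) -p1 -p2 -surjective_pairing eqxx in pp0.
Qed.

(** The weight removed increases at each use of peel and cannot exceed the sum
of the e i. *)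
Lemma weak_algorithm a i0 : homog_relation 0 a -> a i0 != 0 ->
  exists b k i1, [/\ homog_relation k b, b i1 != 0 & e i1 = k].
Proof.
pose m := (\sum_i e i)%N.
have : exists n, (m <= n + 0)%N by exists m; rewrite addn0.
case=> n; move: (0)%N => k; elim: n k a i0 => [|n IHn] k a i0 nk aR ai0.
  have [G Ga] : exists G, G \in msupp (a i0) by apply: msupp_neq0; apply/eqP.
  exists a, k, i0; split=> //; case: (aR) => /(_ _ _ Ga) + _.
  by move: nk; rewrite /m (bigD1 i0) //=; lia.
have [[i1 [e1 a1]]|no] := pselect (exists i1, e i1 = k /\ a i1 != 0).
  by exists a, k, i1.
have [|b [k' [i1 [kk' bR b0]]]] := peel aR ai0.
  move=> i ik; apply/eqP; apply: contrapT => ai.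
  by apply: no; exists i; split=> //; apply/negP.
by apply: (IHn k' b i1); rewrite //; lia.
Qed.
End Peeling.
End FreeActions.

(** * Generalized inverses *)

Section NormalForms.
Variables (F : fieldType) (L : choiceType) (code : L -> nat).
Hypothesis code_inj : injective code.
Variable B : {malg F[L]} -> Prop.
Hypotheses (B0 : B 0) (Blin : forall k x y, B x -> B y -> B (k *: x + y)).
Implicit Types l : L.

Definition leading (f : {malg F[L]}) l :=
  l \in msupp f /\ forall l', l' \in msupp f -> (code l' <= code l)%N.

Lemma leading_ex f : f <> 0 -> exists l, leading f l.
Proof.
move=> /msupp_neq0[l0 l0f].
have [||| l lf lP] := @maximal_ex L (fun x y => code x < code y)%N (msupp f).
- by move=> x /=; rewrite ltnn.
- by move=> x y z /=; apply: ltn_trans.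
- by apply/eqP => f0; move: l0f; rewrite -[_ \in _]/(l0 \in (msupp f : seq L)) f0.
by exists l; split=> // l' /lP; rewrite -leqNgt.
Qed.

(** The leading words of the elements of B; the others form a basis of a
complement of B. *)
Definition reducible l := exists b, B b /\ leading b l.

(** Repeatedly replacing a leading word of B by the lower terms of an element
of B ends, as the code decreases; nf is the resulting normal form. It vanishes
on B because a normal form involves no leading word of an element of B, so that
one that lies in B is zero. *)
Lemma normal_form_ex : exists nf : L -> {malg F[L]},
  (forall l, B (<< l >> - nf l)) /\ forall b, B b -> lext nf b = 0.
Proof.
have BZ k x : B x -> B (k *: x) by move=> Bx; rewrite -[_ *: _]addr0; apply: Blin.
have BD x y : B x -> B y -> B (x + y).
  by move=> Bx By; rewrite -[x]scale1r; apply: Blin.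
have Bsum (K : choiceType) (h : K -> {malg F[L]}) f :
    (forall k, k \in msupp f -> B (h k)) -> B (lext h f).
  rewrite /lext => hB; rewrite big_seq; elim/big_ind: _ => // k kf.
  by apply: BZ; apply: hB.
have /choice[b bP] : forall l, exists b,
    reducible l -> [/\ B b, leading b l & b@_l = 1].
  move=> l; have [[b [Bb [lb bl]]]|] := pselect (reducible l); last by exists 0.
  have bl0 : b@_l != 0 by rewrite mcoeff_neq0.
  exists ((b@_l)^-1 *: b) => _; split; first exact: BZ.
    by split=> [|l']; rewrite msuppZ invr_eq0 (negPf bl0) //; apply: bl.
  by rewrite mcoeffZ mulVf.
(* The fuel n suffices as soon as it exceeds the code of l. *)
pose fix nf (n : nat) (l : L) {struct n} : {malg F[L]} := if n is n'.+1 then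
  if `[< reducible l >] then lext (nf n') (<< l >> - b l) else << l >> else 0.
have tail_lt l l' : reducible l -> l' \in msupp (<< l >> - b l) ->
    (code l' < code l)%N.
  move=> /bP[_ [lb bl] b1] l'P; rewrite ltn_neqAle; apply/andP; split.
    apply: contraL l'P => /eqP/code_inj ->.
    by rewrite -mcoeff_eq0 mcoeffB mcoeffUU b1 subrr.
  have := fsubsetP (msuppB_le _ _) _ l'P; rewrite in_fsetU => /orP[|/bl //].
  by move/(fsubsetP msuppU_le); rewrite in_fset1 => /eqP ->.
have nf_stable n m l : (code l < n)%N -> (code l < m)%N -> nf n l = nf m l.
  elim: n m l => // n IHn [|m] // l ln lm /=; case: asboolP => // /tail_lt lt.
  by apply: eq_lext_supp => l' /lt l'l; apply: IHn; lia.
pose p l := nf (code l).+1 l.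
have pE l : p l = if `[< reducible l >] then lext p (<< l >> - b l) else << l >>.
  rewrite {1}/p -[LHS]/(if _ then lext (nf (code l)) _ else _).
  case: asboolP => // /tail_lt lt.
  by apply: eq_lext_supp => l' /lt l'l; rewrite /p; apply: nf_stable; lia.
have p_ind (P : L -> Prop) :
    (forall l, (forall l', (code l' < code l)%N -> P l') -> P l) -> forall l, P l.
  move=> IH l; have [n] := ubnP (code l); elim: n l => // n IHn l ln.
  by apply: IH => l' l'l; apply: IHn; lia.
have pB l : B (<< l >> - p l).
  elim/p_ind: l => l IH; rewrite pE; case: asboolP => [rl|]; last by rewrite subrr.
  set r := << l >> - b l; have -> : << l >> = r + b l by rewrite subrK.
  rewrite addrAC; apply: BD; last by case: (bP _ rl).
  have -> : r - lext p r = lext (fun l' => << l' >> - p l') r.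
    rewrite {1}[r]malg_lextE -scaleN1r addrC -lext_lin; apply: eq_lext => l'.
    by rewrite scaleN1r addrC.
  by apply: Bsum => l' /(tail_lt _ _ rl); apply: IH.
have p_irr l l' : l' \in msupp (p l) -> ~ reducible l'.
  elim/p_ind: l l' => l IH l'; rewrite pE; case: asboolP => [rl|nrl].
    by case/msupp_lext => l1 /(tail_lt _ _ rl)/IH H /H.
  by move/(fsubsetP msuppU_le); rewrite in_fset1 => /eqP ->.
exists p; split=> // c Bc; apply: contrapT => /leading_ex[l ld].
case: (ld) => /msupp_lext[l1 _ /p_irr nr] _; apply: nr; exists (lext p c); split=> //.
have -> : lext p c = (-1) *: lext (fun l' => << l' >> - p l') c + c.
  rewrite {3}[c]malg_lextE -lext_lin; apply: eq_lext => l'.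
  by rewrite scaleN1r opprB subrK.
exact/Blin/Bc/Bsum.
Qed.
End NormalForms.

(** On the image of E, the map that subtracts the normal form is the identity;
r picks a preimage of its values. So E r is a projection onto the image of E,
and r inverts E on the left when E is injective. *)
Lemma generalized_inverse (F : fieldType) (K L : choiceType) (code : L -> nat)
    (E : {linear {malg F[K]} -> {malg F[L]}}) : injective code ->
  exists r : L -> {malg F[K]}, forall a, E (lext r (E a)) = E a.
Proof.
move=> code_inj; have [||nf [/choice[r rP] nf0]] :=
    @normal_form_ex F L code code_inj (fun x => exists a, E a = x).
- by exists 0; rewrite linear0.
- by move=> k _ _ [x <-] [y <-]; exists (k *: x + y); rewrite linearP.
exists r => a; rewrite linear_lext.
under eq_lext do rewrite rP.
have := lext_lin (-1) nf (fun l => << l >>) (E a).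
rewrite nf0; last by exists a.
rewrite scaler0 add0r -malg_lextE => e; rewrite -[RHS]e.
by apply: eq_lext => l; rewrite scaleN1r addrC.
Qed.

(** * Shuffles *)

Section Shuffles.
Variable T : eqType.
Implicit Types (s t l : seq T) (x y : T).

(** Insertions for this operation are never made inside a letter, so they are
shuffles. *)
Definition rigid s x : seq T := if s is [::] then [:: x] else [::].
Definition shuffles := insertions rigid.

Lemma shuffles0s t : shuffles [::] t = [:: t].
Proof.
elim: t => // y t IHt; rewrite /shuffles insertions_cons splits_nil /=.
by rewrite splits_nil /= -/shuffles IHt.
Qed.

Lemma shuffles_cons x s y t : shuffles (x :: s) (y :: t) =
  [seq y :: l | l <- shuffles (x :: s) t] ++ [seq x :: l | l <- shuffles s (y :: t)].
Proof.
rewrite /shuffles !insertions_cons splits_cons map_cons /= splits_cons /=.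
rewrite cats0 -catA; congr (_ ++ _).
have z U (h : U -> seq (seq T)) r : (forall u, h u = [::]) -> flatten (map h r) = [::].
  by move=> h0; elim: r => //= u r ->; rewrite h0.
rewrite -map_comp z //= -map_comp map_flatten -map_comp; congr flatten.
apply: eq_map => p /=; rewrite map_flatten -map_comp; congr flatten.
apply: eq_map => q /=; case: q.1 => //=; by rewrite !cats0 -map_comp.
Qed.

Lemma shuffles_sym s t l : l \in shuffles s t -> l \in shuffles t s.
Proof.
elim: s t l => [|x s IHs] t l; first by rewrite shuffles0s.
elim: t l => [|y t IHt] l; first by rewrite shuffles0s.
rewrite !shuffles_cons !mem_cat orbC => /orP[] /mapP[l' l'S ->].
  by rewrite map_f ?IHs.
by rewrite [X in _ || X]map_f ?orbT ?IHt.
Qed.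

Lemma shuffles_ex s t : exists l, l \in shuffles s t.
Proof.
elim: s t => [|x s IHs] t; first by exists t; rewrite shuffles0s mem_head.
case: t => [|y t]; first by exists (x :: s); rewrite mem_head.
have [l lS] := IHs (y :: t); exists (x :: l).
by rewrite shuffles_cons mem_cat [X in _ || X]map_f ?orbT.
Qed.

(** A term of an insertion has the largest possible length exactly when
nothing is inserted inside an element. *)
Lemma big_shuffles (V : nmodType) (op : seq T -> T -> seq T) (G : seq T -> V) s t :
  (forall x, op [::] x = [:: x]) ->
  \sum_(l <- insertions op s t | size l == (size s + size t)%N) G l =
  \sum_(l <- shuffles s t) G l.
Proof.
move=> op1; elim: t s G => [|y t IHt] s G.
  by rewrite [LHS]big_mkcond !big_seq1 addn0 eqxx.
elim: s G => [|x s IHs] G.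
  rewrite shuffles0s big_seq1.
  have -> : insertions op [::] (y :: t) = [:: y :: t].
    elim: (t) (y) => [|y' t' IH] z; rewrite insertions_cons splits_nil /=;
      by rewrite splits_nil /= op1 /= ?IH.
  by rewrite [LHS]big_mkcond big_seq1 eqxx.
rewrite shuffles_cons [RHS]big_cat !big_map /= -IHt -IHs [LHS]big_mkcond.
rewrite big_insertions_cons splits_cons big_cons big_map /=.
rewrite splits_cons big_cons.
rewrite big_map /= op1 big_seq1; congr (_ + _).
  rewrite [X in _ + X]big1_seq ?addr0 => [|p /andP[_ /mem_splits pS]].
    by rewrite [RHS]big_mkcond; apply: eq_bigr => r _ /=; rewrite addnS eqSS.
  rewrite big1 // => w _; rewrite big1_seq // => r /andP[_ rI].
  have /= szr := size_insertions rI; case: eqP => //= szE; exfalso.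
  move: szr; rewrite -ltnS szE -pS size_cat addSn addnS !ltnS -addnA.
  by rewrite ltnNge leq_addl.
rewrite [RHS]big_mkcond big_insertions_cons /=; apply: eq_bigr => p _.
apply: eq_bigr => q _; apply: eq_bigr => w _; apply: eq_bigr => r _.
by rewrite /= addSn eqSS.
Qed.

Variable code : T -> nat.
Hypothesis code_inj : injective code.

Fixpoint lex_lt s t := match s, t with
  | x :: s', y :: t' => (code x < code y)%N || (x == y) && lex_lt s' t'
  | _, _ => false
  end.

Lemma lex_lt_irr : irreflexive lex_lt.
Proof. by elim=> //= x s ->; rewrite ltnn andbF. Qed.

Lemma lex_lt_trans : transitive lex_lt.
Proof.
elim=> [|y t IHt] [|x s] [|z u] //= /orP[xy|/andP[/eqP -> st]];
  case/orP=> [yz|/andP[/eqP <- tu]].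
- by rewrite (ltn_trans xy yz).
- by rewrite xy.
- by rewrite yz.
by rewrite eqxx (IHt _ _ st tu) orbT.
Qed.

Lemma lex_lt_total s t : size s = size t -> s != t -> lex_lt s t || lex_lt t s.
Proof.
elim: s t => [|x s IHs] [|y t] //= [/IHs{}IHs].
rewrite eqseq_cons eq_sym; case: (eqVneq y x) => [-> /= /IHs|yx _].
  by rewrite !ltnn.
have: code x != code y by apply: contra_neq yx => /code_inj ->.
by rewrite neq_ltn => /orP[] ->; rewrite ?orbT.
Qed.

(** Apply to u the shuffle that produced l: the first position where the
result changes is one where s and u differ. *)
Lemma shuffles_ltl s u t l : size s = size u -> lex_lt s u -> l \in shuffles s t ->
  exists2 l', l' \in shuffles u t & lex_lt l l'.
Proof.
elim: s u t l => [|x s IHs] [|z u] // t l [szu] su.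
elim: t l => [|y t IHt] l.
  by rewrite inE => /eqP ->; exists (z :: u); rewrite ?mem_head.
rewrite shuffles_cons mem_cat => /orP[] /mapP[l1 l1S ->].
  have [l' l'S ll'] := IHt _ l1S; exists (y :: l').
    by rewrite shuffles_cons mem_cat map_f.
  by rewrite /= eqxx ll' orbT.
case/orP: su => [xz|/andP[/eqP <- su]].
  have [l' l'S] := shuffles_ex u (y :: t); exists (z :: l').
    by rewrite shuffles_cons mem_cat [X in _ || X]map_f ?orbT.
  by rewrite /= xz.
have [l' l'S ll'] := IHs _ _ _ szu su l1S; exists (x :: l').
  by rewrite shuffles_cons mem_cat [X in _ || X]map_f ?orbT.
by rewrite /= eqxx ll' orbT.
Qed.

Lemma shuffles_ltr s u t l : size s = size u -> lex_lt s u -> l \in shuffles t s ->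
  exists2 l', l' \in shuffles t u & lex_lt l l'.
Proof.
move=> szu su /shuffles_sym/(shuffles_ltl szu su)[l' /shuffles_sym]; by exists l'.
Qed.
End Shuffles.

(** The largest word M of the shuffle of the largest words of b and c comes
from no other pair of words, by strict monotonicity; its coefficient is a
product of two nonzero scalars with a positive multiplicity, nonzero in
characteristic zero. *)
Lemma shuffle_domain (F : fieldType) (K : choiceType) (code : K -> nat) n m
    (b c : {malg F[seq K]}) :
  [pchar F] =i pred0 -> injective code ->
  homog size n b -> homog size m c -> bil (@shuffles K) b c = 0 ->
  b = 0 \/ c = 0.
Proof.
move=> charF code_inj bn cm bc0.
have [|/eqP/msupp_neq0[u0 u0b]] := eqVneq b 0; first by left.
have [|/eqP/msupp_neq0[v0 v0c]] := eqVneq c 0; first by right.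
have mx (f : {malg F[seq K]}) k w0 : homog size k f -> w0 \in msupp f ->
    exists2 u, u \in msupp f & forall s, s \in msupp f -> s != u ->
      size s = size u /\ lex_lt code s u.
  move=> fk w0f.
  have [|u uf uP] := maximal_ex (lex_lt_irr code) (@lex_lt_trans _ code)
      (s := msupp f : seq (seq K)).
    by apply/eqP => f0; move: w0f; rewrite -[_ \in _]/(w0 \in (msupp f : seq _)) f0.
  exists u => // s sf su; have szE : size s = size u by rewrite !fk.
  split=> //; have := lex_lt_total code_inj szE su.
  by rewrite (negPf (uP _ sf)) orbF.
have [u ub uP] := mx _ _ _ bn u0b; have [v vc vP] := mx _ _ _ cm v0c.
have [l0 l0S] := shuffles_ex u v.
have [|M MS MP] := maximal_ex (lex_lt_irr code) (@lex_lt_trans _ code)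
    (s := shuffles u v).
  by apply: contraL l0S => /eqP ->.
have notM s t : s \in msupp b -> t \in msupp c -> (s, t) != (u, v) ->
    M \notin shuffles s t.
  move=> sb tc; rewrite xpair_eqE => /nandP st; apply/negP => MSst.
  suff [l lS Ml] : exists2 l, l \in shuffles u v & lex_lt code M l.
    by rewrite (negPf (MP _ lS)) in Ml.
  have [su|su] := eqVneq s u.
    have tv : t != v by case: st => //; rewrite su eqxx.
    have [tvs tvl] := vP _ tc tv; rewrite su in MSst.
    exact: (shuffles_ltr tvs tvl MSst).
  have [sus sul] := uP _ sb su.
  have [l lS Ml] := shuffles_ltl sus sul MSst.
  have [tv|tv] := eqVneq t v; first by exists l; rewrite -?tv.
  have [tvs tvl] := vP _ tc tv.
  have [l' l'S ll'] := shuffles_ltr tvs tvl lS.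
  by exists l' => //; apply: lex_lt_trans Ml ll'.
have := congr1 (mcoeff M) bc0; rewrite mcoeff0 mcoeff_lext (bigD1_seq u) //=.
rewrite mcoeff_lext (bigD1_seq v) //= mcoeff_sumU.
rewrite big1_seq ?addr0 => [|t /andP[tv tc]]; last first.
  rewrite mcoeff_sumU (count_memPn _) ?mulr0 // notM //.
  by rewrite xpair_eqE negb_and tv orbT.
rewrite big1_seq ?addr0 => [|s /andP[su sb]]; last first.
  rewrite mcoeff_lext big1_seq ?mulr0 // => t /andP[_ tc].
  by rewrite mcoeff_sumU (count_memPn _) ?mulr0 // notM // xpair_eqE negb_and su.
move/eqP; rewrite !mulf_eq0 !mcoeff_eq0 ub vc /=.
have /pcharf0P -> := charF.
by rewrite -leqn0 leqNgt -has_count has_pred1 MS.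
Qed.

(** * Evaluation morphisms *)

Section Evaluation.
Variables (F : fieldType) (X Y : choiceType) (g : Y -> Br F X).
Local Notation A := {malg F[bword X]}.
Local Notation H := {malg F[seq (bword X)]}.
Local Notation AY := {malg F[bword Y]}.
Local Notation HY := {malg F[seq (bword Y)]}.

(** Value of a word under the morphism of brace algebras that sends the letter
y to g y. *)
Fixpoint evw (w : bword Y) : A :=
  let: BNode y us := w in Br_brace (map evw us) (g y).

Definition ev : AY -> A := lext evw.
HB.instance Definition _ := GRing.Linear.on ev.

(** The algebra morphism from H over Y to H over X induced by ev. *)
Definition ev_forest : HY -> H := tens_map evw.
HB.instance Definition _ := GRing.Linear.on ev_forest.

Lemma evU w : ev << w >> = evw w. Proof. exact: lextU. Qed.
Lemma ev_forestU s : ev_forest << s >> = tens (map evw s). Proof. exact: lextU. Qed.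

Lemma evwE y us : evw (BNode y us) = Br_brace (map evw us) (g y).
Proof. by []. Qed.

Lemma evw_node y us : evw (BNode y us) = act (ev_forest << us >>) (g y).
Proof. by rewrite ev_forestU -Br_brace_act. Qed.

Lemma evw_wbrace s w :
  Br_brace (map evw s) (evw w) = \sum_(t <- wbrace s w) evw t.
Proof.
elim/bword_nested_ind: w s => y us IH s /=.
rewrite Br_brace_brace big_map.
apply: (big_insertions_image (br := @Br_brace F X) (e := evw)
  (h := fun l => Br_brace l (g y))); last exact: IH.
by move=> ? ? ? ? ?; apply: Br_brace_linearl.
Qed.

Lemma ev_forest_mul a b : ev_forest (mul a b) = mul (ev_forest a) (ev_forest b).
Proof.
apply: (@tens_map_bil F X (@wbrace X) (@Br_brace F X)).
- by move=> *; apply: Br_brace_linearl.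
- exact: Br_brace_linearr.
- exact: Br_brace_word.
- exact: evw_wbrace.
Qed.

Lemma ev_act a f : ev (act a f) = act (ev_forest a) (ev f).
Proof.
move: a f; apply: eq_bilinear => [b k x y|a k x y|b k x y|a k x y|x y].
- by rewrite /act bilDl bilZl linearP.
- by rewrite /act !linearP.
- by rewrite linearP /act bilDl bilZl.
- by rewrite linearP /act linearP.
rewrite /act bilUU linear_sum ev_forestU -/(act _ _) -Br_brace_act evU evw_wbrace.
by apply: eq_bigr => t _; rewrite -evU.
Qed.
End Evaluation.

Lemma tens_map_tens (F : fieldType) (X Y : choiceType) (h : bword X -> Br F Y)
    (fs : seq (Br F X)) :
  tens_map h (tens fs) = tens (map (lext h) fs).
Proof.
move: fs; apply: multilinear_eq => [s t k x y|s t k x y|vs].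
- by rewrite tens_multilinear linearP.
- rewrite !map_cat /= linearP; exact: tens_multilinear.
rewrite tens_word tens_mapU -map_comp; congr tens; apply: eq_map => v.
exact/esym/lextU.
Qed.

Section EvaluationTens.
Variables (F : fieldType) (X Y : choiceType) (g : Y -> Br F X).

Lemma ev_forest_tens (fs : seq (Br F Y)) : ev_forest g (tens fs) = tens (map (ev g) fs).
Proof. exact: tens_map_tens. Qed.

Lemma ev_brace (s : seq (Br F Y)) (a : Br F Y) :
  ev g (Br_brace s a) = Br_brace (map (ev g) s) (ev g a).
Proof. by rewrite !Br_brace_act ev_act ev_forest_tens. Qed.
End EvaluationTens.

Lemma tens_cons (F : fieldType) (X : choiceType) f (fs : seq (Br F X)) :
  tens (f :: fs) = bil (fun w s => [:: w :: s]) f (tens fs).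
Proof.
rewrite /bil -[LHS]/(lext _ f); apply: eq_lext => w.
rewrite /tens [RHS]linear_mlext; apply: mlext_eq => vs.
by rewrite /word_tens /= lextU big_seq1.
Qed.

Lemma homogU (F : fieldType) (K : choiceType) (dg : K -> nat) k :
  homog dg (dg k) (<< k >> : {malg F[K]}).
Proof. by move=> l /(fsubsetP msuppU_le); rewrite in_fset1 => /eqP ->. Qed.

Lemma tens_homog (F : fieldType) (X : choiceType) (fs : seq (Br F X)) :
  homog size (size fs) (tens fs).
Proof.
elim: fs => [|f fs IHfs]; first exact: (@homogU _ _ size [::]).
by rewrite tens_cons => l /msupp_bil[w [s [_ /IHfs sE]]]; rewrite 
  inE => /eqP -> /=; rewrite sE.
Qed.

Lemma tens_map_hcomp_size (F : fieldType) (X K : choiceType) (e : K -> Br F X) n a :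
  tens_map e (hcomp size n a) = hcomp size n (tens_map e a).
Proof.
apply: (eq_linear (L1 := tens_map e \o hcomp size n)
  (L2 := hcomp size n \o tens_map e)) => s /=.
rewrite tens_mapU /hcomp lextU -/(hcomp size n _); case: eqP => [<-|ns].
  by rewrite tens_mapU hcomp_homog // -(size_map e); apply: tens_homog.
rewrite linear0; apply/esym/malgP => l; rewrite mcoeff_hcomp mcoeff0.
case: (size l =P n) => // ln; rewrite mcoeff_outdom //; apply/negP.
by move/tens_homog; rewrite size_map; lia.
Qed.

Section RigidBraces.
Variables (F : fieldType) (X : choiceType).

(** The brace operations that make big_insertions_image and
bil_insertions_tens apply to shuffles. *)
Definition rigid_br (s : seq (Br F X)) (b : Br F X) : Br F X :=
  if s is [::] then b else 0.

Lemma tens_map_shuffles (K : choiceType) (e : K -> Br F X) a b :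
  tens_map e (bil (@shuffles K) a b) =
  bil (@shuffles (bword X)) (tens_map e a) (tens_map e b).
Proof.
apply: (@tens_map_bil F X (@rigid _) rigid_br).
- by move=> a' [|? ?] t k x y /=; rewrite scaler0 addr0.
- by move=> [|? ?] k x y //=; rewrite scaler0 addr0.
- by move=> [|? ?] w /=; rewrite ?big_seq1 ?big_nil.
- by move=> [|? ?] w /=; rewrite ?big_seq1 ?big_nil.
Qed.
End RigidBraces.

Section Cancellation.
Variables (F : fieldType) (X Y : choiceType) (g : Y -> Br F X).
Variable code : bword X -> nat.
Hypotheses (charF : [pchar F] =i pred0) (code_inj : injective code).

(** With theta the tensor power of a projection onto the image of ev, the
element c - theta c has theta-image zero, and its product by the first factor
is fixed by theta, because the image of ev_forest is closed under products. As theta respects lengths and shuffles, the shuffle of the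
two top components is both fixed and killed by theta, hence zero. *)
Lemma ev_forest_cancel U1 U2 c :
  mul (ev_forest g U2) c = ev_forest g U1 -> ev_forest g U2 <> 0 ->
  exists C, c = ev_forest g C.
Proof.
move=> cE U20; have [r rE] := generalized_inverse (ev g) code_inj.
pose theta := tens_map (fun l => ev g (r l) : Br F X).
have theta_phi U : theta (ev_forest g U) = ev_forest g U.
  apply: (eq_linear (L1 := theta \o ev_forest g) (L2 := ev_forest g)) => s /=.
  rewrite ev_forestU /theta tens_map_tens -map_comp; congr tens; apply: eq_map => w /=.
  by rewrite -linear_lext -(evU g) rE.
pose C := tens_map (r : bword X -> Br F Y) c.
have thetaE : theta c = ev_forest g C.
  apply: (eq_linear (L1 := theta)
    (L2 := ev_forest g \o tens_map (r : bword X -> Br F Y))) => s /=.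
  by rewrite /theta !tens_mapU ev_forest_tens -map_comp.
exists C; apply/eqP; rewrite -subr_eq0 -thetaE; apply: contraT => c'0.
set c' := c - theta c in c'0.
have thc' : theta c' = 0 by rewrite /c' /theta linearB /= -/theta thetaE theta_phi subrr.
have mulc' : mul (ev_forest g U2) c' = ev_forest g (U1 - mul U2 C).
  by rewrite /c' linearB /= ev_forest_mul -thetaE -cE /mul linearB.
move/eqP: U20 => /(top_degree size)[n bn hb].
have [m cm hcomp'] := top_degree size c'0.
have topE : hcomp size (n + m) (mul (ev_forest g U2) c') =
    bil (@shuffles (bword X)) (hcomp size n (ev_forest g U2)) (hcomp size m c').
  apply: (hcomp_bil (d1 := size) (d2 := size)) => // [x y z|x y].
    exact: size_insertions.
  by apply: big_shuffles => w; apply: wbrace_nil.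
have [||] // := shuffle_domain (n := n) (m := m) (b := hcomp size n (ev_forest g U2))
    (c := hcomp size m c') charF code_inj (@homog_hcomp _ _ _ _ _) (@homog_hcomp _ _ _ _ _).
- rewrite -topE mulc' -theta_phi -mulc' /theta -tens_map_hcomp_size topE tens_map_shuffles.
  by rewrite [X in bil _ _ X]tens_map_hcomp_size -/theta thc' !linear0.
- by move=> b0; rewrite b0 eqxx in hb.
by move=> b0; rewrite b0 eqxx in hcomp'.
Qed.
End Cancellation.

(** * Leading components *)

Lemma hcomp_bil_graded (F : fieldType) (K1 K2 K3 : choiceType) m
    (d1 : K1 -> nat) (d2 : K2 -> nat) (d3 : K3 -> nat) n n'
    (a : {malg F[K1]}) (b : {malg F[K2]}) :
  (forall x y z, z \in m x y -> d3 z = d1 x + d2 y)%N ->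
  deg_le d1 n a -> deg_le d2 n' b ->
  deg_le d3 (n + n') (bil m a b) /\
  hcomp d3 (n + n') (bil m a b) = bil m (hcomp d1 n a) (hcomp d2 n' b).
Proof.
move=> dm ha hb; split.
  by apply: deg_le_bil ha hb => x y z /dm ->.
apply: (hcomp_bil _ _ ha hb) => x y => [z /dm ->|] //.
rewrite [LHS]big_mkcond; apply: eq_big_seq => z /dm ->; by rewrite eqxx.
Qed.

Lemma hcomp_lext (F : fieldType) (K L : choiceType) (dK : K -> nat) (dL : L -> nat)
    (h hb : K -> {malg F[L]}) n (P : {malg F[K]}) :
  (forall k, deg_le dL (dK k) (h k) /\ hcomp dL (dK k) (h k) = hb k) ->
  deg_le dK n P ->
  deg_le dL n (lext h P) /\ hcomp dL n (lext h P) = lext hb (hcomp dK n P).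
Proof.
move=> hP Pn; split=> [l /msupp_lext[k /Pn kn] /(proj1 (hP k))|]; first by lia.
rewrite linear_lext lext_hcomp; apply: eq_lext_supp => k /Pn kn /=.
have [hk <-] := hP k; case: eqP => [-> //|nk]; apply/malgP => l.
rewrite mcoeff_hcomp mcoeff0; case: (dL l =P n) => // ln.
by rewrite mcoeff_outdom //; apply/negP => /hk; lia.
Qed.

Lemma tens_cons_top (F : fieldType) (X : choiceType) (d : X -> nat) n m f f'
    (fs fs' : seq (Br F X)) :
  deg_le (wt d) n f -> hcomp (wt d) n f = f' ->
  deg_le (fwt d) m (tens fs) -> hcomp (fwt d) m (tens fs) = tens fs' ->
  deg_le (fwt d) (n + m) (tens (f :: fs)) /\
  hcomp (fwt d) (n + m) (tens (f :: fs)) = tens (f' :: fs').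
Proof.
move=> fn <- fsm fsE; rewrite !tens_cons -fsE.
by apply: hcomp_bil_graded => // x y z; rewrite inE => /eqP ->.
Qed.

Lemma Br_brace_top (F : fieldType) (X : choiceType) (d : X -> nat) n m f f'
    (fs fs' : seq (Br F X)) :
  deg_le (fwt d) m (tens fs) -> hcomp (fwt d) m (tens fs) = tens fs' ->
  deg_le (wt d) n f -> hcomp (wt d) n f = f' ->
  deg_le (wt d) (n + m) (Br_brace fs f) /\
  hcomp (wt d) (n + m) (Br_brace fs f) = Br_brace fs' f'.
Proof.
move=> fsm fsE fn <-.
rewrite !Br_brace_act -fsE addnC.
by apply: hcomp_bil_graded => // x y z; apply: wt_wbrace.
Qed.

Local Opaque evw.

Section LeadingComponents.
Variables (F : fieldType) (X Y : choiceType) (d : Y -> nat) (g : Y -> Br F X).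
Local Notation wtX := (wt (fun _ : X => 1%N)).
Local Notation fwtX := (fwt (fun _ : X => 1%N)).
Hypothesis g_deg : forall y, deg_le wtX (d y) (g y).

Variable top_gens : Y -> Br F X.
Hypothesis top_gensE : forall y, hcomp wtX (d y) (g y) = top_gens y.

Lemma tens_top us :
  foldr (fun u => and (deg_le wtX (wt d u) (evw g u) /\
     hcomp wtX (wt d u) (evw g u) = evw top_gens u)) True us ->
  deg_le fwtX (fwt d us) (tens (map (evw g) us)) /\
  hcomp fwtX (fwt d us) (tens (map (evw g) us)) = tens (map (evw top_gens) us).
Proof.
elim: us => [_|u us IHus /= [[uP uE] /IHus[usP usE]]].
  have h0 : homog fwtX 0 (tens [::] : {malg F[seq (bword X)]}).
    exact: (@homogU _ _ fwtX [::]).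
  split; first exact: (homog_deg_le h0).
  exact: (hcomp_homog h0).
exact: tens_cons_top uP uE usP usE.
Qed.

Lemma evw_top w : deg_le wtX (wt d w) (evw g w) /\
  hcomp wtX (wt d w) (evw g w) = evw top_gens w.
Proof.
elim/bword_nested_ind: w => y us /tens_top[usP usE].
rewrite !evwE -[wt d _]/(d y + fwt d us)%N.
exact: Br_brace_top usP usE (@g_deg y) (top_gensE y).
Qed.

Lemma ev_forest_top us : deg_le fwtX (fwt d us) (tens (map (evw g) us)) /\
  hcomp fwtX (fwt d us) (tens (map (evw g) us)) = tens (map (evw top_gens) us).
Proof. by apply: tens_top; apply: foldr_and_all; apply: evw_top. Qed.

Lemma hcomp_ev n P : deg_le (wt d) n P ->
  hcomp wtX n (ev g P) = ev top_gens (hcomp (wt d) n P).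
Proof. by move=> Pn; have [] := hcomp_lext evw_top Pn. Qed.

Lemma hcomp_ev_forest n U : deg_le (fwt d) n U ->
  hcomp fwtX n (ev_forest g U) = ev_forest top_gens (hcomp (fwt d) n U).
Proof. by move=> Un; have [] := hcomp_lext ev_forest_top Un. Qed.

Lemma deg_le_ev_forest n U : deg_le (fwt d) n U -> deg_le fwtX n (ev_forest g U).
Proof. by move=> Un; have [] := hcomp_lext ev_forest_top Un. Qed.

(** The component of top weight of a kernel element would be in the kernel of
the evaluation at the top components. *)
Lemma ev_inj_top : (forall P, ev top_gens P = 0 -> P = 0) ->
  forall P, ev g P = 0 -> P = 0.
Proof.
move=> inj P P0; apply: contrapT => /eqP/(top_degree (wt d))[n Pn].
have e : ev top_gens (hcomp (wt d) n P) = 0 by rewrite -(hcomp_ev Pn) P0 linear0.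
by rewrite (inj _ e) eqxx.
Qed.
End LeadingComponents.

(** * Homogeneous generators *)

Lemma sum_unit (V : nmodType) (G : unit -> V) : \sum_i G i = G tt.
Proof. by rewrite (big_pred1 tt) // => -[]. Qed.

Lemma hcomp_lext_homog (F : fieldType) (K L : choiceType) (dK : K -> nat)
    (dL : L -> nat) (h : K -> {malg F[L]}) n (P : {malg F[K]}) :
  (forall k, homog dL (dK k) (h k)) ->
  hcomp dL n (lext h P) = lext h (hcomp dK n P).
Proof.
move=> hP; rewrite linear_lext lext_hcomp; apply: eq_lext => k /=.
case: eqP => [<-|nk]; first exact: hcomp_homog.
apply/malgP => l; rewrite mcoeff_hcomp mcoeff0; case: (dL l =P n) => // ln.
by rewrite mcoeff_outdom //; apply/negP => /hP; rewrite ln => /esym.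
Qed.

Section Homogeneous.
Variables (F : fieldType) (X : choiceType).
Local Notation A := {malg F[bword X]}.
Local Notation H := {malg F[seq (bword X)]}.
Local Notation wtX := (wt (fun _ : X => 1%N)).
Local Notation fwtX := (fwt (fun _ : X => 1%N)).

Lemma fwt0_scalar (b : H) : homog fwtX 0 b -> b = b@_[::] *: << [::] >>.
Proof.
move=> b0; apply/malgP => s; rewrite mcoeffZ mcoeffU.
case: eqP => [<-|s0]; first by rewrite mulr1.
rewrite mulr0 mcoeff_outdom //; apply/negP => /b0/eqP.
by rewrite (@fwt_eq0 X) // => /eqP e; apply: s0.
Qed.

Lemma actZ1 k (f : A) : act (k *: << [::] >>) f = k *: f.
Proof. by rewrite /act bilZl -/(act _ _) act1. Qed.

Lemma actDl (a b : H) (f : A) : act (a + b) f = act a f + act b f.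
Proof. exact: bilDl. Qed.

(** The weak algorithm for one element: a relation a f = 0 would be shortened
to k f = 0 with k a nonzero scalar. *)
Lemma act_homog_eq0 n (a : H) (f : A) :
  homog fwtX n a -> act a f = 0 -> f <> 0 -> a = 0.
Proof.
move=> an af0 f0; apply: contrapT => /eqP a0.
have [||b [k [[] [[bE bf] b0 nk]]]] :=
  @weak_algorithm F X (fun=> 1%N) (fun=> isT) unit (fun=> f) (fun=> n) (fun=> a) tt.
- by split=> [i G /an -> |]; rewrite ?addn0 // sum_unit.
- exact: a0.
have bs : homog fwtX 0 (b tt) by move=> G /bE; lia.
apply: f0; move: bf; rewrite sum_unit (fwt0_scalar bs) actZ1.
move/eqP; rewrite scaler_eq0 => /orP[/eqP c0|/eqP //].
by rewrite (fwt0_scalar bs) c0 scale0r eqxx in b0.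
Qed.

(** The weak algorithm produces a relation with a nonzero scalar coefficient.
The weights force it to be that of f2, unless f2 has coefficient zero, in
which case f1 would be zero. *)
Lemma left_quotient e1 e2 (a1 a2 : H) (f1 f2 : A) : (e2 <= e1)%N ->
  homog fwtX e1 a1 -> homog fwtX e2 a2 -> a2 <> 0 -> f1 <> 0 ->
  act a1 f1 + act a2 f2 = 0 ->
  exists2 c, homog fwtX (e1 - e2) c & f2 = act c f1.
Proof.
move=> e21 a1e a2e a20 f10 rel.
have [||b [k [i [[bE bf] b0 ik]]]] :=
  @weak_algorithm F X (fun=> 1%N) (fun=> isT) bool (fun i => if i then f2 else f1)
   (fun i => if i then e2 else e1) (fun i => if i then a2 else a1) true.
- split=> [[] G|]; rewrite ?addn0; [exact: a2e | exact: a1e |].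
  by rewrite big_bool /= addrC.
- exact/eqP.
rewrite big_bool /= in bf.
have bF G : G \in msupp (b false) -> (fwtX G + k)%N = e1 by apply: bE.
have bT G : G \in msupp (b true) -> (fwtX G + k)%N = e2 by apply: bE.
have [bT0|bT0] := eqVneq (b true) 0.
  case: i b0 ik => [|bF0 /= ik]; first by rewrite bT0 eqxx.
  have bs : homog fwtX 0 (b false) by move=> G /bF; lia.
  move: bf; rewrite bT0 [act 0 _]bil0l add0r => /(act_homog_eq0 bs)/(_ f10) z.
  by rewrite z eqxx in bF0.
have e2k : e2 = k.
  have [G GT] : exists G, G \in msupp (b true) by apply: msupp_neq0; apply/eqP.
  by case: i ik {b0} => /= ik; have := bT _ GT; lia.
have bs : homog fwtX 0 (b true) by move=> G /bT; lia.
have [u u0 uE] : exists2 u, u != 0 & b true = u *: << [::] >>.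
  exists (b true)@_[::]; last exact: fwt0_scalar.
  by apply: contra bT0 => /eqP u0; rewrite (fwt0_scalar bs) u0 scale0r.
exists (- u^-1 *: b false) => [G|].
  by move/(fsubsetP (msuppZ_le _ _))/bF; lia.
rewrite /act bilZl -/(act _ _); move: bf; rewrite uE actZ1.
move/(canRL (addrK _)); rewrite add0r => f2E.
by apply: (scalerI u0); rewrite f2E scalerA mulrN (mulfV u0) scaleN1r.
Qed.
End Homogeneous.

Definition label (X : choiceType) (w : bword X) := let: BNode x _ := w in x.

Lemma bword_eta (X : choiceType) (w : bword X) : w = BNode (label w) (children w).
Proof. by case: w. Qed.

Section Coordinates.
Variables (F : fieldType) (Y : finType).
Local Notation AY := {malg F[bword Y]}.
Local Notation HY := {malg F[seq (bword Y)]}.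

(** Coordinates in the basis of letters of the free H-module A. *)
Definition root_coord (y : Y) (P : AY) : HY :=
  lext (fun w => if label w == y then << children w >> else 0) P.

Lemma sum_root_coord (V : lmodType F) (B : Y -> {linear HY -> V}) P :
  \sum_y B y (root_coord y P) = lext (fun w => B (label w) << children w >>) P.
Proof.
rewrite /root_coord; under eq_bigr do rewrite linear_lext.
rewrite -lext_sumf; apply: eq_lext => w.
rewrite (bigD1 (label w)) //= eqxx big1 ?addr0 // => y.
by rewrite eq_sym => /negPf ->; rewrite linear0.
Qed.

Lemma msupp_root_coord y P G : G \in msupp (root_coord y P) -> BNode y G \in msupp P.
Proof.
case/msupp_lext => w wP; case: eqP => [<-|_]; last by rewrite msupp0.
by move/(fsubsetP msuppU_le); rewrite in_fset1 => /eqP ->; rewrite -bword_eta.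
Qed.

Lemma root_coord_neq0 P : P <> 0 -> exists y, root_coord y P <> 0.
Proof.
move=> P0; apply: contrapT => no; apply: P0.
have := sum_root_coord (fun y => lext (fun us => << BNode y us >> : AY)) P.
rewrite big1 => [->|y _]; last first.
  suff -> : root_coord y P = 0 by rewrite linear0.
  by apply: contrapT => c0; apply: no; exists y.
rewrite [LHS]malg_lextE; apply: eq_lext => w /=.
by rewrite lextU -bword_eta.
Qed.
End Coordinates.

Section Kernel.
Variables (F : fieldType) (X : choiceType) (Y : finType).
Variable code : bword X -> nat.
Hypothesis code_inj : injective code.
Variables (d : Y -> nat) (g : Y -> Br F X).
Local Notation wtX := (wt (fun _ : X => 1%N)).
Local Notation fwtX := (fwt (fun _ : X => 1%N)).
Hypothesis d_gt0 : forall y, (0 < d y)%N.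
Hypothesis g_homog : forall y, homog wtX (d y) (g y).
Local Notation AY := {malg F[bword Y]}.
Local Notation HY := {malg F[seq (bword Y)]}.

Lemma ev_forest_homog n U : homog (fwt d) n U -> homog fwtX n (ev_forest g U).
Proof.
move=> Un.
have E := @hcomp_ev_forest F X Y d g (fun y => homog_deg_le (@g_homog y)) g
  (fun y => hcomp_homog (@g_homog y)) n U (homog_deg_le Un).
by rewrite (hcomp_homog Un) in E; rewrite -E; apply: homog_hcomp.
Qed.

Lemma hcomp_ev_forest_homog n U :
  hcomp fwtX n (ev_forest g U) = ev_forest g (hcomp (fwt d) n U).
Proof.
apply: hcomp_lext_homog => s; rewrite -ev_forestU.
by apply: ev_forest_homog; apply: homogU.
Qed.

Lemma wt_mem (w : bword Y) s : w \in s -> (wt d w <= fwt d s)%N.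
Proof.
elim: s => // u s IHs; rewrite inE fwt_cons => /orP[/eqP ->|/IHs]; lia.
Qed.

(** A left inverse of ev on words of weight less than n, obtained as a
generalized inverse of ev after truncation, has a tensor power that inverts
ev_forest on the left. *)
Lemma ev_forest_inj_lt n :
  (forall P, (forall w, w \in msupp P -> (wt d w < n)%N) -> ev g P = 0 -> P = 0) ->
  forall U, (forall s, s \in msupp U -> (fwt d s < n)%N) -> ev_forest g U = 0 -> U = 0.
Proof.
move=> inj U Un U0.
pose cut := lext (fun w => if (wt d w < n)%N then << w >> else 0 : AY).
have cutn P w : w \in msupp (cut P) -> (wt d w < n)%N.
  case/msupp_lext => v _; case: ifP => [vn|_]; last by rewrite msupp0.
  by move/(fsubsetP msuppU_le); rewrite in_fset1 => /eqP ->.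
have [r rE] := generalized_inverse (ev g \o cut) code_inj.
pose h (l : bword X) : Br F Y := cut (r l).
have hE w : (wt d w < n)%N -> lext h (evw g w) = << w >>.
  move=> wn; apply/eqP; rewrite -subr_eq0; apply/eqP/inj.
    move=> v /(fsubsetP (msuppB_le _ _)); rewrite in_fsetU => /orP[|].
      by case/msupp_lext => l _; apply: cutn.
    by move/(fsubsetP msuppU_le); rewrite in_fset1 => /eqP ->.
  have cutw : cut << w >> = << w >> by rewrite /cut lextU wn.
  have E : ev g (cut (lext r (ev g (cut << w >>)))) = ev g (cut << w >>) := rE << w >>.
  rewrite cutw evU in E.
  have hcut : lext h (evw g w) = cut (lext r (evw g w)) by rewrite /cut linear_lext.
  by rewrite linearB /= evU hcut E subrr.
have E : tens_map h (ev_forest g U) = U.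
  rewrite [RHS]malg_lextE [LHS](linearE_lext (tens_map h \o ev_forest g)).
  apply: eq_lext_supp => s /Un sn /=.
  rewrite ev_forestU tens_map_tens -map_comp -[RHS]tens_word; congr tens.
  apply/eq_in_map => w /wt_mem ws /=; apply: hE; lia.
by rewrite -E U0 linear0.
Qed.

Lemma ev_root_coord P : ev g P = \sum_y act (ev_forest g (root_coord y P)) (g y).
Proof.
have := sum_root_coord (fun y => bilr (@wbrace X) (g y) \o ev_forest g) P.
move=> /= -> ; apply: eq_lext => w.
by rewrite {1}[w]bword_eta evw_node.
Qed.

(** Take the coordinates of a kernel element that is homogeneous of minimal
weight n. They have weight less than n, since the d y are positive, and
evaluation is injective there. *)
Lemma kernel_relation P : ev g P = 0 -> P <> 0 -> exists n (U : Y -> HY),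
  [/\ forall y s, s \in msupp (U y) -> (fwt d s + d y)%N = n,
      \sum_y act (ev_forest g (U y)) (g y) = 0,
      exists y, ev_forest g (U y) <> 0 &
      forall y, ev_forest g (U y) = 0 -> U y = 0].
Proof.
move=> P0 Pn0; apply: contrapT => no.
have inj n : forall Q, (forall w, w \in msupp Q -> (wt d w < n)%N) ->
    ev g Q = 0 -> Q = 0.
  elim: n => [|n IHn] Q Qn Q0.
    by apply: contrapT => /msupp_neq0[w /Qn].
  have Qle : deg_le (wt d) n Q by move=> w /Qn.
  have hc0 : ev g (hcomp (wt d) n Q) = 0.
    have E := @hcomp_ev F X Y d g (fun y => homog_deg_le (@g_homog y)) g
      (fun y => hcomp_homog (@g_homog y)) n Q Qle.
    by rewrite -E Q0 linear0.
  suff hcQ : hcomp (wt d) n Q = 0.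
    apply: IHn => // w wQ; rewrite ltn_neqAle Qle // andbT; apply/eqP => wn.
    move: wQ; rewrite -mcoeff_neq0.
    by have := mcoeff_hcomp (wt d) n Q w; rewrite hcQ wn eqxx mcoeff0 => <-; rewrite eqxx.
  apply: contrapT => hcn0; apply: no.
  have UE y s : s \in msupp (root_coord y (hcomp (wt d) n Q)) -> (fwt d s + d y)%N = n.
    by move/msupp_root_coord/homog_hcomp <-; rewrite addnC.
  have phi0 y : ev_forest g (root_coord y (hcomp (wt d) n Q)) = 0 ->
      root_coord y (hcomp (wt d) n Q) = 0.
    by apply: (ev_forest_inj_lt IHn) => s /UE; have := d_gt0 y; lia.
  exists n, (fun y => root_coord y (hcomp (wt d) n Q)); split=> //.
    by rewrite -ev_root_coord.
  by have [y cy] := root_coord_neq0 hcn0; exists y => /phi0.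
apply: Pn0; have [m Pm] := deg_le_ex (wt d) P.
by apply: (inj m.+1) => // w /Pm; rewrite ltnS.
Qed.
End Kernel.

Section OneOrTwoGenerators.
Variables (F : fieldType) (X : choiceType).
Variable code : bword X -> nat.
Hypotheses (charF : [pchar F] =i pred0) (code_inj : injective code).
Local Notation wtX := (wt (fun _ : X => 1%N)).
Local Notation fwtX := (fwt (fun _ : X => 1%N)).

Lemma ev_inj_one n (g : unit -> Br F X) : (0 < n)%N -> homog wtX n (g tt) ->
  g tt <> 0 -> forall P, ev g P = 0 -> P = 0.
Proof.
move=> n0 gn g0 P evP; apply: contrapT => Pn0.
have gh y : homog wtX ((fun=> n) y) (g y) by case: y.
have [m [U [UE + [[] U0] _]]] := kernel_relation code_inj (fun=> n0) gh evP Pn0.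
rewrite sum_unit => rel; apply: U0.
apply: (act_homog_eq0 (n := m - n) _ rel g0).
by apply: (ev_forest_homog gh) => s /UE <-; rewrite addnK.
Qed.

(** left_quotient expresses the value at true as c times the value at false,
and act_homog_eq0 turns the relation into an equation in H, to which
ev_forest_cancel applies. The component of weight d true - d false suffices.
*)
Lemma ev_inj_two (d : bool -> nat) (g : bool -> Br F X) P :
  (forall y, 0 < d y)%N -> (d false <= d true)%N ->
  (forall y, homog wtX (d y) (g y)) -> (forall y, g y <> 0) ->
  ev g P = 0 -> P <> 0 ->
  exists2 C, homog (fwt d) (d true - d false) C & g true = act (ev_forest g C) (g false).
Proof.
move=> d0 d12 gh g0 evP Pn0.
have [m [U [UE rel [y0 U0] phi0]]] := kernel_relation code_inj d0 gh evP Pn0.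
have Uh y : homog fwtX (m - d y) (ev_forest g (U y)).
  by apply: (ev_forest_homog gh) => s /UE; lia.
rewrite big_bool /= in rel.
have Un0 y : ev_forest g (U y) <> 0.
  move=> Uy0; case: y Uy0 => Uy0; rewrite Uy0 [act 0 _]bil0l ?add0r ?addr0 in rel.
    have U10 := act_homog_eq0 (Uh false) rel (g0 false).
    by case: y0 U0.
  have U10 := act_homog_eq0 (Uh true) rel (g0 true).
  by case: y0 U0.
have dm y : (d y <= m)%N.
  have [s /UE] : exists s, s \in msupp (U y).
    by apply: msupp_neq0 => Uy0; apply: (Un0 y); rewrite Uy0 linear0.
  lia.
have le21 : (m - d true <= m - d false)%N by lia.
have rel' := rel; rewrite addrC in rel'.
have [c ch gE] := left_quotient le21 (Uh false) (Uh true) (Un0 true) (g0 false) rel'.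
have cE : mul (ev_forest g (U true)) c = ev_forest g (- U false).
  apply/eqP; rewrite linearN -subr_eq0 opprK; apply/eqP.
  apply: (act_homog_eq0 (n := m - d false) _ _ (g0 false)).
    move=> s /(fsubsetP (msuppD_le _ _)); rewrite in_fsetU => /orP[|/Uh //].
    case/msupp_bil => x [y [/Uh xE /ch yE /(fwt_mul (fun=> 1%N)) ->]].
    by have := dm true; have := dm false; lia.
  by rewrite actDl act_mul -gE; exact: rel.
have [C0 C0E] := ev_forest_cancel charF code_inj cE (Un0 true).
have dt := dm true; have df := dm false.
exists (hcomp (fwt d) (d true - d false) C0); first exact: homog_hcomp.
by rewrite -(hcomp_ev_forest_homog gh) -C0E hcomp_homog // => s /ch ->; lia.
Qed.
End OneOrTwoGenerators.

(** * Subalgebras *)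

Section Generation.
Variables (F : fieldType) (X : choiceType).
Local Notation A := (Br F X).
Implicit Types B : A -> Prop.

Lemma subalg_lext B (K : choiceType) (h : K -> A) (f : {malg F[K]}) :
  is_subalg B -> (forall k, k \in msupp f -> B (h k)) -> B (lext h f).
Proof.
case=> B0 Blin _ hB; rewrite /lext big_seq.
elim/big_ind: _ => [//|x y Bx By|k kf].
  by have := Blin 1 _ _ Bx By; rewrite scale1r.
by have := Blin f@_k _ _ (hB _ kf) B0; rewrite addr0.
Qed.

(** The predicate P restricts the letters that may occur; it is only required
to pass to subwords. *)
Lemma subalg_evw B (Y : choiceType) (g : Y -> A) (P : pred (bword Y)) w :
  is_subalg B -> (forall y us, P (BNode y us) -> B (g y) /\ all P us) ->
  P w -> B (evw g w).
Proof.
move=> BA PP; have [_ _ Bbr] := BA.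
elim/bword_nested_ind: w => y us IH /PP[By Pus]; rewrite evwE.
have us_ok : forall b, b \in map (evw g) us -> B b.
  elim: us IH Pus => //= u us IHus [Hu Hus] /andP[Pu Pus] b.
  by rewrite inE => /orP[/eqP ->|/(IHus Hus Pus)]; first exact: Hu.
exact: Bbr us_ok By.
Qed.

Lemma subalg_ev B (Y : choiceType) (g : Y -> A) P :
  is_subalg B -> (forall y, B (g y)) -> B (ev g P).
Proof.
move=> BA Bg; apply: subalg_lext => // w _.
by apply: (@subalg_evw B Y g predT) => // y us _; split=> //; apply/allP.
Qed.

Lemma ev_image_subalg (Y : choiceType) (g : Y -> A) :
  is_subalg (fun x : A => exists P, ev g P = x).
Proof.
split; first by exists 0; rewrite linear0.
  by move=> k _ _ [P <-] [Q <-]; exists (k *: P + Q); rewrite linearP.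
move=> s _ sB [P <-].
have [Qs <-] : exists Qs : seq (Br F Y), map (ev g) Qs = s.
  elim: s sB => [|a s IHs] sB; first by exists [::].
  have [|Qs <-] := IHs; first by move=> x xs; apply: sB; rewrite inE xs orbT.
  by have [Q <-] := sB a (mem_head _ _); exists (Q :: Qs).
by exists (Br_brace Qs P); rewrite ev_brace.
Qed.

Lemma subalg_gen_is_subalg (S : A -> Prop) :
  is_subalg (fun x : A => x \in subalg_gen S).
Proof.
split; first exact: rpred0.
  by move=> k x y xS yS; apply: rpredD => //; apply: rpredZ.
by move=> s a sS aS; apply: subalg_brace_closed.
Qed.

Lemma subalg_gen_sub (S : A -> Prop) a : S a -> a \in subalg_gen S.
Proof. by move=> Sa; apply/asboolP => B _ SB; apply: SB. Qed.

Lemma free_subalg (Y : choiceType) (g : Y -> A) (S : A -> Prop) :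
  (forall P, ev g P = 0 -> P = 0) -> (forall y, g y \in subalg_gen S) ->
  (forall a, S a -> exists P, ev g P = a) ->
  is_free_brace_alg (subalg_gen_of S).
Proof.
move=> inj gS Sg.
have evS P : ev g P \in subalg_gen S.
  exact: (subalg_ev (B := fun x => x \in subalg_gen S) P (subalg_gen_is_subalg S)).
pose f (P : Br F Y) : subalg_gen_of S := SubalgGenOf (evS P).
exists Y, f; split.
- by move=> k x y; apply: val_inj; rewrite /= linearP.
- move=> s a; apply: val_inj; rewrite /= ev_brace -map_comp.
  by congr Br_brace.
have f_surj s : exists P, f P = s.
  have /asboolP/(_ _ (ev_image_subalg g) Sg)[P PE] := valP s.
  by exists P; apply: val_inj.
have [h hK] := choice f_surj.
exists h => // P; apply/eqP; rewrite -subr_eq0; apply/eqP/inj.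
rewrite linearB /=; apply/eqP; rewrite subr_eq0; apply/eqP.
exact: (congr1 val (hK (f P))).
Qed.
End Generation.

(** * Two generators *)

Section TwoGenerators.
Variables (F : fieldType) (X : choiceType).
Variable code : bword X -> nat.
Hypotheses (charF : [pchar F] =i pred0) (code_inj : injective code).
Local Notation A := (Br F X).
Local Notation wtX := (wt (fun _ : X => 1%N)).
Local Notation fwtX := (fwt (fun _ : X => 1%N)).
Local Notation gen f1 f2 := (subalg_gen (fun f : A => f = f1 \/ f = f2)).

Definition freely_generated (f1 f2 : A) := exists (Y : finType) (g : Y -> A),
  [/\ forall P, ev g P = 0 -> P = 0, forall y, g y \in gen f1 f2,
      exists P, ev g P = f1 & exists P, ev g P = f2].

Lemma freely_generated_sym f1 f2 : freely_generated f1 f2 -> freely_generated f2 f1.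
Proof.
case=> Y [g [inj gS P1 P2]]; exists Y, g; split=> // y.
have /asboolP gy := gS y; apply/asboolP => B BA SB.
by apply: gy => // a [->|->]; apply: SB; [right|left].
Qed.

Lemma top_le_deg k n (f : A) : deg_le wtX n f -> hcomp wtX k f != 0 -> (k <= n)%N.
Proof.
by move=> fn /eqP/msupp_neq0[w wf]; rewrite -(homog_hcomp wf) fn // (msupp_hcomp wf).
Qed.

Lemma wtX_gt0 (f : A) n : hcomp wtX n f != 0 -> (0 < n)%N.
Proof.
move/eqP/msupp_neq0 => [w /homog_hcomp <-]; exact: wt_gt0.
Qed.

Lemma freely_generated_inj (g : bool -> A) : (forall P, ev g P = 0 -> P = 0) ->
  freely_generated (g false) (g true).
Proof.
move=> inj; exists bool, g; split=> //.
- by move=> y; apply: subalg_gen_sub; case: y; [right|left].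
- by exists << BNode false [::] >>; rewrite evU evwE; apply: Br_brace_nil.
by exists << BNode true [::] >>; rewrite evU evwE; apply: Br_brace_nil.
Qed.

Lemma freely_generated_one (f1 f2 : A) n : deg_le wtX n f1 -> hcomp wtX n f1 != 0 ->
  (forall B : A -> Prop, is_subalg B -> B f1 -> B f2) -> freely_generated f1 f2.
Proof.
move=> f1n f10 f2B; pose g (y : unit) : A := f1.
have evg : exists P, ev g P = f1.
  by exists << BNode tt [::] >>; rewrite evU evwE; apply: Br_brace_nil.
exists unit, g; split=> //.
- apply: (@ev_inj_top F X unit (fun=> n) g (fun=> f1n) (fun=> hcomp wtX n f1)) => //.
  apply: (ev_inj_one code_inj (wtX_gt0 f10)) => //; last exact/eqP.
  exact: homog_hcomp.
- by move=> y; apply: subalg_gen_sub; left.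
exact: (f2B _ (ev_image_subalg g)).
Qed.

Lemma freely_generated_reduce (f1 f2 h : A) :
  (forall B : A -> Prop, is_subalg B -> B f1 -> B h) ->
  freely_generated f1 (f2 - h) -> freely_generated f1 f2.
Proof.
move=> hB [Y [g [inj gS P1 P2]]]; exists Y, g.
have f12A := subalg_gen_is_subalg (fun f : A => f = f1 \/ f = f2).
have f1S : f1 \in gen f1 f2 by apply: subalg_gen_sub; left.
have f2S : f2 \in gen f1 f2 by apply: subalg_gen_sub; right.
split=> //.
  move=> y; have /asboolP/(_ _ f12A) := gS y; apply=> a [->//|->].
  by apply: rpredB => //; apply: (hB _ f12A).
have imA := ev_image_subalg g.
have := hB _ imA P1; case: P2 => [P2 e2] [Q eh].
by exists (P2 + Q); rewrite linearD /= e2 eh subrK.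
Qed.

(** If the top components are not free generators, ev_inj_two writes that of
f2 as C evaluated at the top components and applied to that of f1; h is the
same expression in f2 and f1. The words occurring in C have weight less than
d2, so that f2 does not occur in h. *)
Lemma reduce_leading d1 d2 (f1 f2 : A) : (d1 <= d2)%N ->
  deg_le wtX d1 f1 -> deg_le wtX d2 f2 -> hcomp wtX d1 f1 != 0 -> hcomp wtX d2 f2 != 0 ->
  freely_generated f1 f2 \/
  exists h : A, [/\ forall B : A -> Prop, is_subalg B -> B f1 -> B h,
    deg_le wtX d2 (f2 - h) & hcomp wtX d2 (f2 - h) = 0].
Proof.
move=> d12 f1d f2d f10 f20.
pose g (y : bool) : A := if y then f2 else f1.
pose d (y : bool) := if y then d2 else d1.
pose gt (y : bool) : A := hcomp wtX (d y) (g y).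
have gd y : deg_le wtX (d y) (g y) by case: y.
have gtE y : hcomp wtX (d y) (g y) = gt y by [].
have gt0 y : gt y <> 0 by case: y; [exact: (elimN eqP f20) | exact: (elimN eqP f10)].
have d_gt0 y : (0 < d y)%N by case: y; apply: wtX_gt0; [exact: f20 | exact: f10].
have gth y : homog wtX (d y) (gt y) by apply: homog_hcomp.
clearbody gt.
have [inj|/existsNP[P /not_implyP[P0 Pn0]]] :=
    pselect (forall P, ev gt P = 0 -> P = 0).
  by left; apply: (freely_generated_inj (g := g)); apply: (ev_inj_top gd gtE inj).
right; have [C Ch gtC] := ev_inj_two charF code_inj d_gt0 d12 gth gt0 P0 Pn0.
exists (act (ev_forest g C) f1).
have [hle hE] := hcomp_bil_graded (@wt_wbrace X (fun=> 1%N))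
   (deg_le_ev_forest gd gtE (homog_deg_le Ch)) (f1d : deg_le wtX (d false) f1).
rewrite subnK // in hle hE; split.
- move=> B BA Bf1.
  rewrite /ev_forest /tens_map /act bil_lextl; apply: subalg_lext => // s /Ch sE.
  rewrite -/(act _ _) -Br_brace_act; case: (BA) => _ _; apply=> //.
  move=> _ /mapP[w ws ->].
  apply: (subalg_evw (P := fun w => (wt d w < d2)%N) BA).
    move=> y us usw; have {}usw : (d y + fwt d us < d2)%N := usw.
    case: y usw => usw; first by move: usw; rewrite /d ltnNge leq_addr.
    split=> //; apply/allP => u /(wt_mem d) uus.
    by apply: leq_ltn_trans usw; apply: leq_trans uus (leq_addl _ _).
  have dlt : (d true - d false < d true)%N by rewrite ltn_subrL !d_gt0.
  by apply: leq_ltn_trans dlt; rewrite -sE; apply: wt_mem.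
- by apply: deg_leD => //; apply: deg_leN.
rewrite linearB /=; apply/eqP; rewrite subr_eq0; apply/eqP.
rewrite [RHS]hE (hcomp_ev_forest gd gtE (homog_deg_le Ch)) (hcomp_homog Ch).
have e2 : hcomp wtX d2 f2 = gt true := gtE true.
have e1 : hcomp wtX (d false) f1 = gt false := gtE false.
rewrite e2 e1 gtC.
exact: erefl.
Qed.

(** Induction on the sum of degree bounds, which decreases when f2 is replaced
by f2 - h. *)
Lemma two_generators (f1 f2 : A) : f1 != 0 -> f2 != 0 -> freely_generated f1 f2.
Proof.
move=> f10 f20.
have [n1 f1n] := deg_le_ex wtX f1; have [n2 f2n] := deg_le_ex wtX f2.
have [N] := ubnP (n1 + n2); elim: N n1 n2 f1 f2 f10 f20 f1n f2n => // N IHN.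
have step n1 n2 (f1 f2 : A) d1 d2 : (n1 + n2 < N.+1)%N ->
    deg_le wtX n1 f1 -> deg_le wtX n2 f2 ->
    (d1 <= d2)%N ->
  deg_le wtX d1 f1 -> deg_le wtX d2 f2 -> hcomp wtX d1 f1 != 0 -> hcomp wtX d2 f2 != 0 ->
  freely_generated f1 f2.
  move=> nN f1n f2n d12 f1d f2d f10 f20.
  have [//|[h [hB hd hd0]]] := reduce_leading d12 f1d f2d f10 f20.
  have d1n1 := top_le_deg f1n f10; have d2n2 := top_le_deg f2n f20.
  have [h0|h0] := eqVneq (f2 - h) 0.
    apply: (freely_generated_one f1d f10) => B BA Bf1.
    by move/eqP: h0; rewrite subr_eq0 => /eqP ->; apply: hB.
  have [d' hd' hd'0] := top_degree wtX h0.
  have d'd2 : (d' < d2)%N.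
    rewrite ltn_neqAle (top_le_deg hd hd'0) andbT.
    by apply: contra hd'0 => /eqP ->; rewrite hd0.
  apply: (freely_generated_reduce hB).
  apply: (IHN d1 d') => //; last by lia.
  by apply: contra f10 => /eqP ->; rewrite linear0.
move=> n1 n2 f1 f2 f10 f20 f1n f2n nN.
have [d1 f1d f1d0] := top_degree wtX f10; have [d2 f2d f2d0] := top_degree wtX f20.
have [d12|d21] := leqP d1 d2; first exact: (step n1 n2 f1 f2 d1 d2).
apply: freely_generated_sym.
by apply: (step n2 n1 f2 f1 d2 d1); rewrite // 1?addnC // ltnW.
Qed.
End TwoGenerators.

Lemma bword_code_nat (X : countType) : exists code : bword X -> nat, injective code.
Proof.
exists (fun w => choice.pickle (bword_code w : GenTree.tree X)) => v w.
move/(pcan_inj (@choice.pickleK _)).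
exact: (pcan_inj (@bword_codeK X)).
Qed.

Theorem theorem4p3 (F : fieldType) (charF : [pchar F] =i pred0) (X : finType)
    (f1 f2 : Br F X) (f1_neq0 : f1 != 0) (f2_neq0 : f2 != 0) :
  is_free_brace_alg (subalg_gen_of (fun f : Br F X => f = f1 \/ f = f2)).
Proof.
have [code code_inj] := bword_code_nat X.
have [Y [g [inj gS P1 P2]]] := two_generators charF code_inj f1_neq0 f2_neq0.
by apply: (free_subalg inj gS) => a [->|->].
Qed.
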